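(* For all $\tau\in\mathbb{H}$, $$h\!\left(\frac{2\tau-1}{7\tau-3}\right)=\frac{h(\tau)-1}{h(\tau)}.$$
   Context: Let $\tau\in\mathbb{H}$, $q=e^{2\pi i\tau}$. Define $h(\tau)=q^{-1}\prod_{k\ge0}\frac{(1-q^{7k+3})(1-q^{7k+4})(1-q^{7k+2})^2(1-q^{7k+5})^2}{(1-q^{7k+1})^3(1-q^{7k+6})^3}$; equivalently $h=uv^2/w^3$ with $u=q^{1/56}\prod_{k\ge0}(1-q^{7k+3})(1-q^{7k+4})(1-q^{7k+7})$, $v=q^{9/56}\prod_{k\ge0}(1-q^{7k+2})(1-q^{7k+5})(1-q^{7k+7})$, $w=q^{25/56}\prod_{k\ge0}(1-q^{7k+1})(1-q^{7k+6})(1-q^{7k+7})$, where $q^\alpha=e^{2\pi i\alpha\tau}$. *)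

(* Defs.v *)
From Stdlib Require Import Reals Epsilon.
From Coquelicot Require Import Coquelicot.
Open Scope R_scope.

Definition Cexp (z : C) : C :=
  (exp (Re z) * cos (Im z), exp (Re z) * sin (Im z)).

Definition qnome (tau : C) : C := Cexp (Cmult (RtoC (2 * PI)) (Cmult Ci tau)).

(* value of a convergent infinite product: the limit of the partial products
   prod_{k < N} a k as N -> oo (unique since C is Hausdorff). *)
Fixpoint Cpartial_prod (a : nat -> C) (N : nat) : C :=
  match N with
  | O => RtoC 1
  | S n => Cmult (Cpartial_prod a n) (a n)
  end.

Definition Cprod_inf (a : nat -> C) : C :=
  epsilon (inhabits (RtoC 0))
    (fun l => filterlim (Cpartial_prod a) eventually (locally l)).

Definition one_minus_qpow (q : C) (n : nat) : C := Cminus (RtoC 1) (pow_n q n).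

Definition h_factor (q : C) (k : nat) : C :=
  Cdiv
    (Cmult (Cmult (one_minus_qpow q (7*k+3)) (one_minus_qpow q (7*k+4)))
           (Cmult (pow_n (one_minus_qpow q (7*k+2)) 2) (pow_n (one_minus_qpow q (7*k+5)) 2)))
    (Cmult (pow_n (one_minus_qpow q (7*k+1)) 3) (pow_n (one_minus_qpow q (7*k+6)) 3)).

Definition h (tau : C) : C :=
  Cmult (Cinv (qnome tau)) (Cprod_inf (h_factor (qnome tau))).

(* Main.v *)
Require Import Defs.
From Stdlib Require Import Reals Lra Lia Psatz ZArith Epsilon.
From Coquelicot Require Import Coquelicot.
Open Scope R_scope.

(* Write q = e^(2 pi i tau) and let th_r be the theta function of nome q^7 at q^r, so that
   h = th_3 th_2^2 / (q th_1^3) by the Jacobi triple product.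

   The product of (l + 3z)(l - 5z)(l - 2z) / ((l - 6z)(l + z)^2) over a lattice Z w + Z converges
   absolutely, so it can be evaluated along rows or along columns. Both times Euler's sine product
   turns it into a quotient of theta functions, of nomes e(w) and e(-1/w) respectively. For
   w = 7 tau - 3 and z = tau the first one is - h(tau); the second one is th_2 th_1^2 q / th_3^3 at
   g = (2 tau - 1)/(7 tau - 3), because - 1/w = 7 g - 2 and tau/w = 1 - 3 g.

   Weierstrass' three-term relation for theta functions at the points q^3, q^2, q, 1 is the Klein
   quartic th_3 th_2^3 - q th_2 th_1^3 = th_3^3 th_1, that is, h - 1 = th_3^3 / (q th_2 th_1^2).
   Hence h(tau) = - 1/(h(g) - 1). *)

(** * Limits of complex sequences *)

(** The multiples 3, -5, -2 over -6, 1, 1 arise as follows. Since 7 tau = w + 3, the point z = tau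
    is a 7-division point of Z w + Z, and up to sign these multiples are 3, 2, 2 over 1, 1, 1 modulo
    7, the indices in h. The representatives are chosen with equal sums and equal sums of squares,
    which is what makes the double product absolutely convergent. For a single theta function the
    double product converges only conditionally, and exchanging rows and columns costs an automorphy
    factor; in this quotient nothing of the kind is left, so no multiplier has to be computed. As
    tau/w is -3 g up to an integer, the exchange multiplies the indices by -3 modulo 7, sending 3,
    2, 1 to 2, 1, 3 up to sign. The factors are 1 + O(|l|^-3) on a two-dimensional lattice. For an
    exchange that uses one-dimensional sums only, this is weakened to (1 + |m|)^(-3/2) (1 +
    |n|)^(-3/2), a product of two summable weights. Within one row, Euler's sine product is still
    only conditionally convergent; hence the symmetric partial products over -N..N. *)

Definition Clim (u : nat -> C) (l : C) : Prop :=
  is_lim_seq (fun n => Cmod (u n - l)) 0.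

Lemma Clim_squeeze (u : nat -> C) (l : C) (v : nat -> R) :
  is_lim_seq v 0 ->
  eventually (fun n => Cmod (u n - l) <= v n) -> Clim u l.
Proof.
  intros Hv H.
  apply (is_lim_seq_le_le_loc (fun _ => 0) _ v); auto.
  - destruct H as [N H]; exists N; intros n Hn; split; auto using Cmod_ge_0.
  - apply is_lim_seq_const.
Qed.

Lemma Clim_ext_loc (u v : nat -> C) (l : C) :
  eventually (fun n => u n = v n) -> Clim u l -> Clim v l.
Proof.
  intros [N H]. apply is_lim_seq_ext_loc.
  exists N; intros n Hn; now rewrite (H n Hn).
Qed.

Lemma Clim_ext (u v : nat -> C) (l : C) :
  (forall n, u n = v n) -> Clim u l -> Clim v l.
Proof. intros H; apply Clim_ext_loc; exists O; auto. Qed.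

Lemma Clim_const (c : C) : Clim (fun _ => c) c.
Proof.
  apply is_lim_seq_ext with (fun _ => 0); [|apply is_lim_seq_const].
  intros _. replace (c - c)%C with (RtoC 0) by ring. now rewrite Cmod_0.
Qed.

Lemma Clim_plus (u v : nat -> C) (l m : C) :
  Clim u l -> Clim v m -> Clim (fun n => u n + v n)%C (l + m)%C.
Proof.
  intros Hu Hv.
  apply Clim_squeeze with (fun n => Cmod (u n - l) + Cmod (v n - m)).
  - replace (Finite 0) with (Finite (0 + 0)) by (f_equal; ring).
    now apply is_lim_seq_plus'.
  - exists O; intros n _.
    replace (u n + v n - (l + m))%C with ((u n - l) + (v n - m))%C by ring.
    apply Cmod_triangle.
Qed.

Lemma Clim_mult (u v : nat -> C) (l m : C) :
  Clim u l -> Clim v m -> Clim (fun n => u n * v n)%C (l * m)%C.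
Proof.
  intros Hu Hv.
  apply Clim_squeeze with (fun n => Cmod (u n - l) * Cmod (v n - m)
     + (Cmod l * Cmod (v n - m) + Cmod m * Cmod (u n - l))).
  - replace (Finite 0) with (Finite (0 * 0 + (Cmod l * 0 + Cmod m * 0)))
      by (f_equal; ring).
    apply is_lim_seq_plus'; [now apply is_lim_seq_mult'|].
    apply is_lim_seq_plus'; apply is_lim_seq_mult'; auto using is_lim_seq_const.
  - exists O; intros n _.
    replace (u n * v n - l * m)%C
      with ((u n - l) * (v n - m) + (l * (v n - m) + m * (u n - l)))%C by ring.
    eapply Rle_trans; [apply Cmod_triangle|]. rewrite Cmod_mult.
    apply Rplus_le_compat_l.
    eapply Rle_trans; [apply Cmod_triangle|]. rewrite !Cmod_mult. lra.
Qed.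

Lemma Clim_scal (c : C) (u : nat -> C) (l : C) :
  Clim u l -> Clim (fun n => c * u n)%C (c * l)%C.
Proof. intros; apply Clim_mult; auto using Clim_const. Qed.

Lemma Clim_opp (u : nat -> C) (l : C) : Clim u l -> Clim (fun n => - u n)%C (- l)%C.
Proof.
  intros H. apply (Clim_scal (-1)) in H.
  replace (- l)%C with (-1 * l)%C by ring.
  revert H; apply Clim_ext; intros; ring.
Qed.

Lemma Clim_minus (u v : nat -> C) (l m : C) :
  Clim u l -> Clim v m -> Clim (fun n => u n - v n)%C (l - m)%C.
Proof. intros Hu Hv; apply Clim_plus; [|apply Clim_opp]; auto. Qed.

Lemma Clim_pow (u : nat -> C) (l : C) (k : nat) :
  Clim u l -> Clim (fun n => u n ^ k)%C (l ^ k)%C.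
Proof.
  intros H; induction k; simpl; [apply Clim_const | now apply Clim_mult].
Qed.

Lemma Clim_subseq (u : nat -> C) (l : C) (phi : nat -> nat) :
  filterlim phi eventually eventually -> Clim u l -> Clim (fun n => u (phi n)) l.
Proof. intros Hphi H. apply (is_lim_seq_subseq (fun n => Cmod (u n - l))); auto. Qed.

Lemma Clim_eventually_lt (u : nat -> C) (l : C) (eps : R) :
  Clim u l -> 0 < eps -> eventually (fun n => Cmod (u n - l) < eps).
Proof.
  intros H He. destruct (proj2 (is_lim_seq_spec _ _) H (mkposreal eps He)) as [N HN].
  exists N; intros n Hn. specialize (HN n Hn). simpl in HN.
  rewrite Rminus_0_r in HN. eapply Rle_lt_trans; [apply Rle_abs|]; eauto.
Qed.

Lemma Clim_intro (u : nat -> C) (l : C) :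
  (forall eps, 0 < eps -> eventually (fun n => Cmod (u n - l) < eps)) -> Clim u l.
Proof.
  intros H. apply is_lim_seq_spec. intros eps.
  destruct (H eps (cond_pos eps)) as [N HN]. exists N; intros n Hn.
  rewrite Rminus_0_r, Rabs_pos_eq; auto using Cmod_ge_0.
Qed.

Lemma Clim_unique (u : nat -> C) (l m : C) : Clim u l -> Clim u m -> l = m.
Proof.
  intros Hl Hm.
  assert (H : Clim (fun n => u n - u n)%C (l - m)%C) by now apply Clim_minus.
  assert (E : is_lim_seq (fun _ => Cmod (l - m)) 0).
  { revert H; apply is_lim_seq_ext; intros n.
    replace (u n - u n - (l - m))%C with (- (l - m))%C by ring. apply Cmod_opp. }
  apply is_lim_seq_unique in E. rewrite Lim_seq_const in E. injection E; intros E'.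
  apply Cmod_eq_0 in E'. replace l with (l - m + m)%C by ring. rewrite E'; ring.
Qed.

Lemma Clim_Cmod (u : nat -> C) (l : C) : Clim u l -> is_lim_seq (fun n => Cmod (u n)) (Cmod l).
Proof.
  intros H.
  apply is_lim_seq_ext with (fun n => Cmod l + (Cmod (u n) - Cmod l)); [intros; ring|].
  replace (Finite (Cmod l)) with (Finite (Cmod l + 0)) by (f_equal; ring).
  apply is_lim_seq_plus'; [apply is_lim_seq_const|].
  apply is_lim_seq_abs_0.
  apply (is_lim_seq_le_le (fun _ => 0) _ (fun n => Cmod (u n - l))); auto using is_lim_seq_const.
  intros n; split; [apply Rabs_pos|].
  apply Rabs_le_between.
  pose proof (Cmod_triangle (u n - l) l) as H1.
  replace (u n - l + l)%C with (u n) in H1 by ring.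
  pose proof (Cmod_triangle (- (u n - l)) (u n)) as H2.
  replace (- (u n - l) + u n)%C with l in H2 by ring.
  rewrite Cmod_opp in H2. lra.
Qed.

Lemma Clim_le (u : nat -> C) (l : C) (K : R) :
  eventually (fun n => Cmod (u n) <= K) -> Clim u l -> Cmod l <= K.
Proof.
  intros H Hl. apply Clim_Cmod in Hl.
  apply (is_lim_seq_le_loc (fun n => Cmod (u n)) (fun _ => K) (Cmod l) K); auto.
  apply is_lim_seq_const.
Qed.

Lemma Clim_ge (u : nat -> C) (l : C) (K : R) :
  eventually (fun n => K <= Cmod (u n)) -> Clim u l -> K <= Cmod l.
Proof.
  intros H Hl. apply Clim_Cmod in Hl.
  apply (is_lim_seq_le_loc (fun _ => K) (fun n => Cmod (u n)) K (Cmod l)); auto.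
  apply is_lim_seq_const.
Qed.

Lemma Clim_bounded (u : nat -> C) (l : C) :
  Clim u l -> exists K, 0 < K /\ forall n, Cmod (u n) <= K.
Proof.
  intros H. destruct (Clim_eventually_lt u l 1 H Rlt_0_1) as [N HN].
  assert (HB : exists B, 0 <= B /\ forall n, (n < N)%nat -> Cmod (u n) <= B).
  { clear. induction N as [|N [B [HB IH]]]; [exists 0; split; [lra | lia]|].
    exists (Rmax B (Cmod (u N))); split; [eapply Rle_trans; [|apply Rmax_l]; auto|].
    intros n Hn. destruct (Nat.eq_dec n N) as [->|]; [apply Rmax_r|].
    eapply Rle_trans; [apply IH; lia | apply Rmax_l]. }
  destruct HB as [B [HB0 HB]].
  exists (B + (Cmod l + 1)); split; [pose proof (Cmod_ge_0 l); lra|].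
  intros n. destruct (le_lt_dec N n) as [Hn|Hn].
  - specialize (HN n Hn). pose proof (Cmod_triangle (u n - l) l) as T.
    replace (u n - l + l)%C with (u n) in T by ring. lra.
  - specialize (HB n Hn). pose proof (Cmod_ge_0 l). lra.
Qed.

Lemma Clim_inv (u : nat -> C) (l : C) :
  l <> 0 -> Clim u l -> Clim (fun n => / u n)%C (/ l)%C.
Proof.
  intros Hl H.
  assert (Pl : 0 < Cmod l) by now apply Cmod_gt_0.
  apply Clim_squeeze with (fun n => Cmod (u n - l) * (2 / (Cmod l * Cmod l))).
  - replace (Finite 0) with (Finite (0 * (2 / (Cmod l * Cmod l)))) by (f_equal; ring).
    apply is_lim_seq_mult'; auto using is_lim_seq_const.
  - destruct (Clim_eventually_lt u l (Cmod l / 2) H ltac:(lra)) as [N HN].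
    exists N; intros n Hn; specialize (HN n Hn).
    pose proof (Cmod_triangle (- (u n - l)) (u n)) as T.
    replace (- (u n - l) + u n)%C with l in T by ring. rewrite Cmod_opp in T.
    assert (Hu : u n <> 0) by (apply Cmod_gt_0; lra).
    replace (/ u n - / l)%C with (- (u n - l) / (u n * l))%C by (field; auto).
    rewrite Cmod_div, Cmod_opp, Cmod_mult by (apply Cmult_neq_0; auto).
    unfold Rdiv. apply Rmult_le_compat_l; [apply Cmod_ge_0|].
    replace (2 * / (Cmod l * Cmod l)) with (/ (Cmod l / 2 * Cmod l)) by (field; lra).
    apply Rinv_le_contravar; nra.
Qed.

Lemma Clim_div (u v : nat -> C) (l m : C) :
  m <> 0 -> Clim u l -> Clim v m -> Clim (fun n => u n / v n)%C (l / m)%C.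
Proof. intros; apply Clim_mult; auto using Clim_inv. Qed.

Lemma Cmod_le_Re_Im (z : C) : Cmod z <= Rabs (Re z) + Rabs (Im z).
Proof.
  destruct z as [a b]. unfold Cmod, Re, Im; simpl fst; simpl snd.
  rewrite <- (sqrt_pow2 (Rabs a + Rabs b)) by (pose proof (Rabs_pos a); pose proof (Rabs_pos b); lra).
  apply sqrt_le_1_alt. rewrite <- (pow2_abs a), <- (pow2_abs b).
  pose proof (Rabs_pos a); pose proof (Rabs_pos b); nra.
Qed.

Lemma Rabs_Im_le_Cmod (z : C) : Rabs (Im z) <= Cmod z.
Proof. eapply Rle_trans; [apply Rmax_r | apply (Rmax_Cmod z)]. Qed.

Lemma Clim_of_parts (u : nat -> C) (a b : R) :
  is_lim_seq (fun n => Re (u n)) a -> is_lim_seq (fun n => Im (u n)) b -> Clim u (a, b).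
Proof.
  intros Ha Hb.
  apply Clim_squeeze with (fun n => Rabs (Re (u n) - a) + Rabs (Im (u n) - b)).
  - replace (Finite 0) with (Finite (0 + 0)) by (f_equal; ring).
    apply is_lim_seq_plus'; apply (is_lim_seq_abs_0 (fun n => _ - _)).
    + replace (Finite 0) with (Finite (a - a)) by (f_equal; ring).
      apply is_lim_seq_minus'; auto using is_lim_seq_const.
    + replace (Finite 0) with (Finite (b - b)) by (f_equal; ring).
      apply is_lim_seq_minus'; auto using is_lim_seq_const.
  - exists O; intros n _. eapply Rle_trans; [apply Cmod_le_Re_Im|].
    apply Req_le. f_equal; f_equal; destruct (u n); reflexivity.
Qed.

(** Completeness is borrowed from R: real and imaginary part are 1-Lipschitz for [Cmod], so one
    argument with a generic projection [p] serves both. The bound depends on the smaller index only,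
    the shape in which tails of series and products arise. *)
Lemma Clim_Cauchy (u : nat -> C) (d : nat -> R) :
  is_lim_seq d 0 -> (forall m n, (m <= n)%nat -> Cmod (u n - u m) <= d m) ->
  exists l, Clim u l.
Proof.
  intros Hd H.
  assert (K : forall p : C -> R, (forall x y, Rabs (p x - p y) <= Cmod (x - y)) ->
            ex_finite_lim_seq (fun n => p (u n))).
  { intros p Hp. apply ex_lim_seq_cauchy_corr. intros eps.
    assert (He : 0 < eps / 2) by (destruct eps; simpl; lra).
    destruct (proj2 (is_lim_seq_spec _ _) Hd (mkposreal _ He)) as [N HN].
    exists N; intros n m Hn Hm.
    assert (HdN : d N < eps / 2).
    { specialize (HN N (le_n _)). simpl in HN. rewrite Rminus_0_r in HN.
      eapply Rle_lt_trans; [apply Rle_abs|]; eauto. }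
    pose proof (H N n Hn) as H1. pose proof (H N m Hm) as H2.
    pose proof (Hp (u n) (u N)) as H3. pose proof (Hp (u m) (u N)) as H4.
    replace (p (u n) - p (u m)) with ((p (u n) - p (u N)) - (p (u m) - p (u N))) by ring.
    eapply Rle_lt_trans; [apply Rabs_triang|]. rewrite Rabs_Ropp. lra. }
  destruct (K Re) as [a Ha].
  { intros x y. replace (Re x - Re y) with (Re (x - y)%C) by (destruct x, y; reflexivity).
    apply re_le_Cmod. }
  destruct (K Im) as [b Hb].
  { intros x y. replace (Im x - Im y) with (Im (x - y)%C) by (destruct x, y; reflexivity).
    apply Rabs_Im_le_Cmod. }
  exists (a, b). now apply Clim_of_parts.
Qed.

(* A Moore-Osgood theorem: [d] makes the limits in the second index uniform in the first. *)
Lemma Clim_exchange (X : nat -> nat -> C) (U Y : nat -> C) (l : C) (d : nat -> R) :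
  (forall k, Clim (X k) (U k)) -> (forall n, Clim (fun k => X k n) (Y n)) ->
  Clim Y l -> is_lim_seq d 0 ->
  (forall k m n, (m <= n)%nat -> Cmod (X k n - X k m) <= d m) ->
  Clim U l.
Proof.
  intros HR HY Hl Hd H; apply Clim_intro. intros eps He.
  assert (He3 : 0 < eps / 3) by lra.
  destruct (Clim_eventually_lt Y l _ Hl He3) as [N1 HN1].
  destruct (proj2 (is_lim_seq_spec _ _) Hd (mkposreal _ He3)) as [N2 HN2].
  set (M := max N1 N2).
  assert (A1 : Cmod (Y M - l) < eps / 3) by (apply HN1; unfold M; lia).
  assert (A2 : d M < eps / 3).
  { specialize (HN2 M ltac:(unfold M; lia)). simpl in HN2. rewrite Rminus_0_r in HN2.
    eapply Rle_lt_trans; [apply Rle_abs|]; eauto. }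
  destruct (Clim_eventually_lt _ _ _ (HY M) He3) as [N3 HN3].
  exists N3; intros k Hk. specialize (HN3 k Hk). simpl in HN3.
  assert (A3 : Cmod (U k - X k M) <= d M).
  { apply (Clim_le (fun n => X k n - X k M)%C).
    - exists M; intros n Hn; auto.
    - apply Clim_minus; auto using Clim_const. }
  replace (U k - l)%C with ((U k - X k M) + ((X k M - Y M) + (Y M - l)))%C by ring.
  eapply Rle_lt_trans; [apply Cmod_triangle|].
  eapply Rle_lt_trans; [apply Rplus_le_compat_l, Cmod_triangle|]. lra.
Qed.

(** A total limit operator, meaningful only through [Clim_val_unique]; it allows [theta] to be a
    plain function that carries no convergence proof. *)
Definition Clim_val (u : nat -> C) : C :=
  (real (Lim_seq (fun n => Re (u n))), real (Lim_seq (fun n => Im (u n)))).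

Lemma Clim_parts (u : nat -> C) (l : C) : Clim u l ->
  is_lim_seq (fun n => Re (u n)) (Re l) /\ is_lim_seq (fun n => Im (u n)) (Im l).
Proof.
  intros H.
  assert (K : forall p : C -> R, (forall x y, Rabs (p x - p y) <= Cmod (x - y)) ->
            is_lim_seq (fun n => p (u n)) (p l)).
  { intros p Hp.
    apply is_lim_seq_ext with (fun n => p l + (p (u n) - p l)); [intros; ring|].
    replace (Finite (p l)) with (Finite (p l + 0)) by (f_equal; ring).
    apply is_lim_seq_plus'; [apply is_lim_seq_const|].
    apply is_lim_seq_abs_0.
    apply (is_lim_seq_le_le (fun _ => 0) _ (fun n => Cmod (u n - l))); auto using is_lim_seq_const.
    intros n; split; [apply Rabs_pos | apply Hp]. }
  split; apply K; intros x y.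
  - replace (Re x - Re y) with (Re (x - y)%C) by (destruct x, y; reflexivity).
    apply re_le_Cmod.
  - replace (Im x - Im y) with (Im (x - y)%C) by (destruct x, y; reflexivity).
    apply Rabs_Im_le_Cmod.
Qed.

Lemma Clim_val_unique (u : nat -> C) (l : C) : Clim u l -> Clim_val u = l.
Proof.
  intros H. destruct (Clim_parts u l H) as [H1 H2].
  unfold Clim_val. rewrite (is_lim_seq_unique _ _ H1), (is_lim_seq_unique _ _ H2).
  now destruct l.
Qed.

(** [epsilon] selects some limit of the partial products: the given [l] shows that there is one, and
    uniqueness of limits identifies the two. *)
Lemma Cprod_inf_Clim (a : nat -> C) (l : C) :
  Clim (Cpartial_prod a) l -> Cprod_inf a = l.
Proof.
  intros H.
  assert (F : forall m, Clim (Cpartial_prod a) m ->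
     filterlim (Cpartial_prod a) eventually (locally m)).
  { intros m Hm. apply filterlim_locally. intros eps.
    destruct (Clim_eventually_lt _ _ _ Hm (cond_pos eps)) as [N HN].
    exists N; intros n Hn. apply C_NormedModule_mixin_compat1. now apply HN. }
  unfold Cprod_inf.
  assert (E := epsilon_spec (inhabits (RtoC 0))
    (fun l0 : C => filterlim (Cpartial_prod a) eventually (locally l0))
    (ex_intro _ l (F l H))).
  simpl in E.
  exact (@filterlim_locally_unique nat C_AbsRing C_NormedModule _ _ _ _ _ E (F l H)).
Qed.

(** * Symmetric sums and products over the integers *)

Fixpoint Cpartial_sum (a : nat -> C) (N : nat) : C :=
  match N with O => RtoC 0 | S n => Cplus (Cpartial_sum a n) (a n) end.

Fixpoint Rpartial_sum (a : nat -> R) (N : nat) : R :=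
  match N with O => 0 | S n => Rpartial_sum a n + a n end.

Definition zpos (k : nat) : Z := Z.of_nat (S k).
Definition zneg (k : nat) : Z := (- Z.of_nat (S k))%Z.

(** Sum over -N..N, stored as the term at 0 followed by N symmetric pairs. The pairing is what turns
    a bilateral product of linear factors into the one-sided product of Euler. *)
Definition zsum (f : Z -> C) (N : nat) : C :=
  (f 0%Z + Cpartial_sum (fun k => f (zpos k) + f (zneg k)) N)%C.

Definition zsumR (f : Z -> R) (N : nat) : R :=
  f 0%Z + Rpartial_sum (fun k => f (zpos k) + f (zneg k)) N.

Definition zprod (f : Z -> C) (N : nat) : C :=
  (f 0%Z * Cpartial_prod (fun k => f (zpos k) * f (zneg k)) N)%C.

Lemma zsum_S f N : zsum f (S N) = (zsum f N + (f (zpos N) + f (zneg N)))%C.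
Proof. unfold zsum; simpl; ring. Qed.

Lemma zsumR_S f N : zsumR f (S N) = zsumR f N + (f (zpos N) + f (zneg N)).
Proof. unfold zsumR; simpl; ring. Qed.

Lemma zprod_S f N : zprod f (S N) = (zprod f N * (f (zpos N) * f (zneg N)))%C.
Proof. unfold zprod; simpl; ring. Qed.

Lemma zsum_0 f : zsum f 0 = f 0%Z.
Proof. unfold zsum; simpl; ring. Qed.

Lemma zsumR_0 f : zsumR f 0 = f 0%Z.
Proof. unfold zsumR; simpl; ring. Qed.

Lemma zprod_0 f : zprod f 0 = f 0%Z.
Proof. unfold zprod; simpl; ring. Qed.

Lemma zprod_ext f g N : (forall n, f n = g n) -> zprod f N = zprod g N.
Proof. intros H; induction N; [rewrite !zprod_0 | rewrite !zprod_S, IHN, !H]; auto. Qed.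

Lemma zsum_ext f g N : (forall n, f n = g n) -> zsum f N = zsum g N.
Proof. intros H; induction N; [rewrite !zsum_0 | rewrite !zsum_S, IHN, !H]; auto. Qed.

Lemma zprod_mult f g N : zprod (fun n => f n * g n)%C N = (zprod f N * zprod g N)%C.
Proof. induction N; [rewrite !zprod_0 | rewrite !zprod_S, IHN]; ring. Qed.

Lemma zprod_neq_0 (f : Z -> C) N : (forall n, f n <> 0) -> zprod f N <> 0.
Proof.
  intros H; induction N; [rewrite zprod_0; auto | rewrite zprod_S].
  apply Cmult_neq_0; [|apply Cmult_neq_0]; auto.
Qed.

Lemma zprod_inv (f : Z -> C) N : (forall n, f n <> 0) -> zprod (fun n => / f n)%C N = (/ zprod f N)%C.
Proof.
  intros H; induction N; [now rewrite !zprod_0 | rewrite !zprod_S, IHN].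
  pose proof (zprod_neq_0 f N H). field; auto.
Qed.

Lemma zprod_div (f g : Z -> C) N : (forall n, g n <> 0) ->
  zprod (fun n => f n / g n)%C N = (zprod f N / zprod g N)%C.
Proof. intros H. unfold Cdiv. now rewrite zprod_mult, zprod_inv. Qed.

Lemma zprod_pow f k N : zprod (fun n => f n ^ k)%C N = (zprod f N ^ k)%C.
Proof.
  induction N; [now rewrite !zprod_0 | rewrite !zprod_S, IHN]. now rewrite !Cpow_mult_l.
Qed.

Lemma zprod_opp f N : zprod (fun n => f (- n)%Z) N = zprod f N.
Proof.
  induction N; [now rewrite !zprod_0 | rewrite !zprod_S, IHN].
  unfold zpos, zneg. rewrite Z.opp_involutive; ring.
Qed.

Lemma zprod_swap (f : Z -> Z -> C) M N :
  zprod (fun m => zprod (f m) N) M = zprod (fun n => zprod (fun m => f m n) M) N.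
Proof.
  induction M.
  - rewrite zprod_0. apply zprod_ext; intros; now rewrite zprod_0.
  - rewrite zprod_S, IHM, <- !zprod_mult. apply zprod_ext; intros; now rewrite zprod_S.
Qed.

Lemma zsum_plus f g N : zsum (fun n => f n + g n)%C N = (zsum f N + zsum g N)%C.
Proof. induction N; [rewrite !zsum_0 | rewrite !zsum_S, IHN]; ring. Qed.

Lemma zsum_scal c f N : zsum (fun n => c * f n)%C N = (c * zsum f N)%C.
Proof. induction N; [rewrite !zsum_0 | rewrite !zsum_S, IHN]; ring. Qed.

Lemma zsum_swap (f : Z -> Z -> C) M N :
  zsum (fun m => zsum (f m) N) M = zsum (fun n => zsum (fun m => f m n) M) N.
Proof.
  induction M.
  - rewrite zsum_0. apply zsum_ext; intros; now rewrite zsum_0.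
  - rewrite zsum_S, IHM, <- !zsum_plus. apply zsum_ext; intros; now rewrite zsum_S.
Qed.

Lemma zsum_succ f N :
  zsum (fun n => f (n + 1)%Z) N = (zsum f N + f (Z.of_nat N + 1)%Z - f (- Z.of_nat N)%Z)%C.
Proof.
  induction N.
  - rewrite !zsum_0. simpl. ring.
  - rewrite !zsum_S, IHN. unfold zpos, zneg.
    replace (- Z.of_nat (S N) + 1)%Z with (- Z.of_nat N)%Z by lia.
    replace (Z.of_nat (S N)) with (Z.of_nat N + 1)%Z by lia. ring.
Qed.

Lemma zsum_opp f N : zsum (fun n => f (- n)%Z) N = zsum f N.
Proof.
  induction N; [now rewrite !zsum_0 | rewrite !zsum_S, IHN].
  unfold zpos, zneg. rewrite Z.opp_involutive; ring.
Qed.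

(** The even indices fill -2N..2N but the odd ones run from -2N+1 to 2N+1, so the odd window sticks
    out by one term on the right. *)
Lemma zsum_even_odd f N :
  (zsum (fun k => f (2 * k)%Z) N + zsum (fun k => f (2 * k + 1)%Z) N)%C =
  (zsum f (2 * N) + f (2 * Z.of_nat N + 1)%Z)%C.
Proof.
  induction N; [rewrite !zsum_0; simpl; ring|].
  replace (2 * S N)%nat with (S (S (2 * N))) by lia.
  rewrite !zsum_S.
  transitivity (zsum (fun k => f (2 * k)%Z) N + zsum (fun k => f (2 * k + 1)%Z) N +
   (f (2 * zpos N)%Z + f (2 * zneg N)%Z + f (2 * zpos N + 1)%Z + f (2 * zneg N + 1)%Z))%C; [ring|].
  rewrite IHN. unfold zpos, zneg.
  replace (2 * Z.of_nat (S N))%Z with (Z.of_nat (S (S (2 * N)))) by lia.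
  replace (2 * - Z.of_nat (S N))%Z with (- Z.of_nat (S (S (2 * N))))%Z by lia.
  replace (- Z.of_nat (S (S (2 * N))) + 1)%Z with (- Z.of_nat (S (2 * N)))%Z by lia.
  replace (2 * Z.of_nat N + 1)%Z with (Z.of_nat (S (2 * N))) by lia.
  ring.
Qed.

Lemma Clim_zprod (f : nat -> Z -> C) (g : Z -> C) N :
  (forall n, Clim (fun k => f k n) (g n)) -> Clim (fun k => zprod (f k) N) (zprod g N).
Proof.
  intros H; induction N.
  - rewrite zprod_0. eapply Clim_ext; [|apply H]; intros; now rewrite zprod_0.
  - rewrite zprod_S. eapply Clim_ext; [intros; symmetry; apply zprod_S|].
    apply Clim_mult; [|apply Clim_mult]; auto.
Qed.

Lemma Clim_zsum (f : nat -> Z -> C) (g : Z -> C) N :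
  (forall n, Clim (fun k => f k n) (g n)) -> Clim (fun k => zsum (f k) N) (zsum g N).
Proof.
  intros H; induction N.
  - rewrite zsum_0. eapply Clim_ext; [|apply H]; intros; now rewrite zsum_0.
  - rewrite zsum_S. eapply Clim_ext; [intros; symmetry; apply zsum_S|].
    apply Clim_plus; [|apply Clim_plus]; auto.
Qed.

Lemma Clim_partial_prod (f : nat -> nat -> C) (g : nat -> C) N :
  (forall n, Clim (fun k => f k n) (g n)) ->
  Clim (fun k => Cpartial_prod (f k) N) (Cpartial_prod g N).
Proof.
  intros H; induction N; simpl; [apply Clim_const | apply Clim_mult; auto].
Qed.

Lemma Cpartial_prod_ext f g N : (forall n, (n < N)%nat -> f n = g n) ->
  Cpartial_prod f N = Cpartial_prod g N.
Proof. intros H; induction N; simpl; auto. rewrite IHN, H; auto. Qed.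

Lemma Cpartial_prod_mult f g N :
  Cpartial_prod (fun n => f n * g n)%C N = (Cpartial_prod f N * Cpartial_prod g N)%C.
Proof. induction N; simpl; [|rewrite IHN]; ring. Qed.

Lemma Cpartial_prod_neq_0 (f : nat -> C) N : (forall n, f n <> 0) -> Cpartial_prod f N <> 0.
Proof.
  intros H; induction N; simpl; [|apply Cmult_neq_0; auto].
  intros E. injection E; lra.
Qed.

Lemma zsumR_pos b N : (forall n, 0 <= b n) -> 0 <= zsumR b N.
Proof.
  intros H; induction N; [rewrite zsumR_0; auto | rewrite zsumR_S].
  pose proof (H (zpos N)); pose proof (H (zneg N)); lra.
Qed.

Lemma zsumR_scal c f N : zsumR (fun n => c * f n) N = c * zsumR f N.
Proof. induction N; [rewrite !zsumR_0 | rewrite !zsumR_S, IHN]; ring. Qed.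

Lemma zsumR_incr b m n : (forall n, 0 <= b n) -> (m <= n)%nat -> zsumR b m <= zsumR b n.
Proof.
  intros Hb H; induction H; [lra|]. rewrite zsumR_S.
  pose proof (Hb (zpos m0)); pose proof (Hb (zneg m0)); lra.
Qed.

Lemma zsumR_le_lim (b : Z -> R) (B : R) N : (forall n, 0 <= b n) -> is_lim_seq (zsumR b) B -> zsumR b N <= B.
Proof.
  intros Hb H. apply (is_lim_seq_le_loc (fun _ => zsumR b N) (zsumR b) (zsumR b N) B);
    auto using is_lim_seq_const.
  exists N; intros; now apply zsumR_incr.
Qed.

Lemma zsum_dist (f : Z -> C) (b : Z -> R) m n :
  (forall n, Cmod (f n) <= b n) -> (m <= n)%nat ->
  Cmod (zsum f n - zsum f m) <= zsumR b n - zsumR b m.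
Proof.
  intros H Hmn; induction Hmn as [|n Hmn IH].
  - replace (zsum f m - zsum f m)%C with (RtoC 0) by ring. rewrite Cmod_0; lra.
  - rewrite zsum_S, zsumR_S.
    replace (zsum f n + (f (zpos n) + f (zneg n)) - zsum f m)%C
      with ((zsum f n - zsum f m) + (f (zpos n) + f (zneg n)))%C by ring.
    eapply Rle_trans; [apply Cmod_triangle|].
    pose proof (Cmod_triangle (f (zpos n)) (f (zneg n))).
    pose proof (H (zpos n)); pose proof (H (zneg n)); lra.
Qed.

Lemma zsum_bound (f : Z -> C) (b : Z -> R) n :
  (forall n, Cmod (f n) <= b n) -> Cmod (zsum f n) <= zsumR b n.
Proof.
  intros H; induction n as [|n IH]; [rewrite zsum_0, zsumR_0; auto|].
  rewrite zsum_S, zsumR_S.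
  eapply Rle_trans; [apply Cmod_triangle|].
  pose proof (Cmod_triangle (f (zpos n)) (f (zneg n))).
  pose proof (H (zpos n)); pose proof (H (zneg n)); lra.
Qed.

Lemma zsum_cv (f : Z -> C) (b : Z -> R) (B : R) :
  (forall n, Cmod (f n) <= b n) -> is_lim_seq (zsumR b) B -> exists l, Clim (zsum f) l.
Proof.
  intros H HB. assert (Hb : forall n, 0 <= b n).
  { intros n; eapply Rle_trans; [apply Cmod_ge_0 | apply H]. }
  apply (Clim_Cauchy _ (fun m => B - zsumR b m)).
  - replace (Finite 0) with (Finite (B - B)) by (f_equal; ring).
    apply is_lim_seq_minus'; auto using is_lim_seq_const.
  - intros m n Hmn. pose proof (zsum_dist f b m n H Hmn).
    pose proof (zsumR_le_lim b B n Hb HB); lra.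
Qed.

(** Bounds of the form exp a - 1 are closed under products, because (exp a - 1)(exp b - 1) + (exp a
    - 1) + (exp b - 1) = exp (a + b) - 1. All product estimates below rest on this. *)
Lemma mult_dist_1 (x y : C) (a b : R) :
  Cmod (x - 1) <= exp a - 1 -> Cmod (y - 1) <= exp b - 1 ->
  Cmod (x * y - 1) <= exp (a + b) - 1.
Proof.
  intros Hx Hy. rewrite exp_plus.
  replace (x * y - 1)%C with ((x - 1) * (y - 1) + ((x - 1) + (y - 1)))%C by ring.
  eapply Rle_trans; [apply Cmod_triangle|]. rewrite Cmod_mult.
  pose proof (Cmod_triangle (x - 1) (y - 1)).
  pose proof (Cmod_ge_0 (x - 1)); pose proof (Cmod_ge_0 (y - 1)). nra.
Qed.

Lemma zprod_dist_1 (f : Z -> C) (b : Z -> R) n :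
  (forall n, Cmod (f n - 1) <= exp (b n) - 1) ->
  Cmod (zprod f n - 1) <= exp (zsumR b n) - 1.
Proof.
  intros H; induction n; [rewrite zprod_0, zsumR_0; auto | rewrite zprod_S, zsumR_S].
  auto using mult_dist_1.
Qed.

(** The bound is the same difference for the majorant product of the numbers exp (b n); it sees [f]
    only through [b], which gives uniformity in parameters. *)
Lemma zprod_dist (f : Z -> C) (b : Z -> R) m n :
  (forall n, Cmod (f n - 1) <= exp (b n) - 1) -> (m <= n)%nat ->
  Cmod (zprod f n - zprod f m) <= exp (zsumR b n) - exp (zsumR b m).
Proof.
  intros H Hmn; induction Hmn as [|n Hmn IH].
  - replace (zprod f m - zprod f m)%C with (RtoC 0) by ring. rewrite Cmod_0; lra.
  - rewrite zprod_S, zsumR_S, exp_plus.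
    set (u := (f (zpos n) * f (zneg n))%C).
    assert (Hu : Cmod (u - 1) <= exp (b (zpos n) + b (zneg n)) - 1) by (now apply mult_dist_1).
    replace (zprod f n * u - zprod f m)%C
      with (zprod f n * (u - 1) + (zprod f n - zprod f m))%C by ring.
    eapply Rle_trans; [apply Cmod_triangle|]. rewrite Cmod_mult.
    assert (Hp : Cmod (zprod f n) <= exp (zsumR b n)).
    { pose proof (zprod_dist_1 f b n H). pose proof (Cmod_triangle (zprod f n - 1) 1) as T.
      replace (zprod f n - 1 + 1)%C with (zprod f n) in T by ring. rewrite Cmod_1 in T. lra. }
    pose proof (Cmod_ge_0 (u - 1)); pose proof (Cmod_ge_0 (zprod f n)).
    pose proof (exp_pos (zsumR b n)). nra.
Qed.

Lemma exp_le_compat x y : x <= y -> exp x <= exp y.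
Proof. intros [H| ->]; [left; now apply exp_increasing | right; reflexivity]. Qed.

Lemma is_lim_seq_exp_diff (b : nat -> R) (B : R) :
  is_lim_seq b B -> is_lim_seq (fun m => exp B - exp (b m)) 0.
Proof.
  intros H. replace (Finite 0) with (Finite (exp B - exp B)) by (f_equal; ring).
  apply is_lim_seq_minus'; [apply is_lim_seq_const|].
  apply (is_lim_seq_continuous exp); auto.
  apply derivable_continuous_pt, derivable_pt_exp.
Qed.

(** Fubini for double products. The majorant in product form makes every column, cut at any number
    of rows, differ from 1 by at most exp (A * b n) - 1, so convergence in the column index is
    uniform in the number of rows. *)
Lemma zprod_exchange (f : Z -> Z -> C) (a b : Z -> R) (A B : R) (r c : Z -> C) (l : C) :
  (forall m, 0 <= a m) -> (forall n, 0 <= b n) ->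
  (forall m n, Cmod (f m n - 1) <= a m * b n) ->
  is_lim_seq (zsumR a) A -> is_lim_seq (zsumR b) B ->
  (forall m, Clim (zprod (f m)) (r m)) ->
  (forall n, Clim (zprod (fun m => f m n)) (c n)) ->
  Clim (zprod c) l -> Clim (zprod r) l.
Proof.
  intros Ha Hb Hf HA HB Hr Hc Hl.
  assert (A0 : forall N, zsumR a N <= A) by (intros; now apply zsumR_le_lim).
  assert (HAB : is_lim_seq (zsumR (fun n => A * b n)) (A * B)).
  { apply is_lim_seq_ext with (fun n => A * zsumR b n).
    - intros; now rewrite zsumR_scal.
    - apply is_lim_seq_mult'; auto using is_lim_seq_const. }
  assert (Ap : 0 <= A) by (eapply Rle_trans; [apply (zsumR_pos a O Ha) | apply A0]).
  apply (Clim_exchange (fun k n => zprod (fun m => zprod (f m) n) k) (zprod r) (zprod c) l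
    (fun m => exp (A * B) - exp (zsumR (fun n => A * b n) m))); auto.
  - intros k. now apply Clim_zprod.
  - intros n. eapply Clim_ext; [intros; symmetry; apply zprod_swap|]. now apply Clim_zprod.
  - now apply is_lim_seq_exp_diff.
  (* After the swap, the truncated columns are the factors of a single product, and [zprod_dist]
     applies with weights [A * b n] that do not involve [k]. *)
  - intros k m n Hmn. rewrite (zprod_swap f k n), (zprod_swap f k m).
    eapply Rle_trans; [apply zprod_dist with (b := fun n => A * b n); auto|].
    + intros j.
      eapply Rle_trans; [apply zprod_dist_1 with (b := fun m => b j * a m)|].
      * intros i. pose proof (Hf i j). pose proof (exp_ineq1_le (b j * a i)). lra.
      * rewrite zsumR_scal. apply Rplus_le_compat_r, exp_le_compat.
        rewrite Rmult_comm. apply Rmult_le_compat_r; auto.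
    + apply Rplus_le_compat_r, exp_le_compat, zsumR_le_lim; auto.
      intros; apply Rmult_le_pos; auto.
Qed.

Lemma zsum_exchange (f : Z -> Z -> C) (a b : Z -> R) (A B : R) (r c : Z -> C) (l : C) :
  (forall m, 0 <= a m) -> (forall n, 0 <= b n) ->
  (forall m n, Cmod (f m n) <= a m * b n) ->
  is_lim_seq (zsumR a) A -> is_lim_seq (zsumR b) B ->
  (forall m, Clim (zsum (f m)) (r m)) ->
  (forall n, Clim (zsum (fun m => f m n)) (c n)) ->
  Clim (zsum c) l -> Clim (zsum r) l.
Proof.
  intros Ha Hb Hf HA HB Hr Hc Hl.
  assert (A0 : forall N, zsumR a N <= A) by (intros; now apply zsumR_le_lim).
  assert (Ap : 0 <= A) by (eapply Rle_trans; [apply (zsumR_pos a O Ha) | apply A0]).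
  apply (Clim_exchange (fun k n => zsum (fun m => zsum (f m) n) k) (zsum r) (zsum c) l
    (fun m => A * B - A * zsumR b m)); auto.
  - intros k. now apply Clim_zsum.
  - intros n. eapply Clim_ext; [intros; symmetry; apply zsum_swap|]. now apply Clim_zsum.
  - replace (Finite 0) with (Finite (A * B - A * B)) by (f_equal; ring).
    apply is_lim_seq_minus'; [apply is_lim_seq_const|].
    apply is_lim_seq_mult'; auto using is_lim_seq_const.
  - intros k m n Hmn. rewrite (zsum_swap f k n), (zsum_swap f k m).
    eapply Rle_trans; [apply zsum_dist with (b := fun n => A * b n); auto|].
    + intros j.
      eapply Rle_trans; [apply zsum_bound with (b := fun m => b j * a m)|].
      * intros i. pose proof (Hf i j). lra.
      * rewrite zsumR_scal. rewrite Rmult_comm. apply Rmult_le_compat_r; auto.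
    + rewrite !zsumR_scal. apply Rplus_le_compat_r, Rmult_le_compat_l; auto.
      now apply zsumR_le_lim.
Qed.

(** * One-sided infinite products and their non-vanishing *)

Lemma Rpartial_sum_le_lim (b : nat -> R) (B : R) N : (forall n, 0 <= b n) ->
  is_lim_seq (Rpartial_sum b) B -> Rpartial_sum b N <= B.
Proof.
  intros Hb H.
  apply (is_lim_seq_le_loc (fun _ => Rpartial_sum b N) (Rpartial_sum b) (Rpartial_sum b N) B);
    auto using is_lim_seq_const.
  exists N; intros n Hn; induction Hn; simpl; [lra|]. pose proof (Hb m); lra.
Qed.

(** The error is relative to the partial product at [m]; an absolute bound would not exclude that
    the limit vanishes. *)
Lemma Cpartial_prod_dist (f : nat -> C) (b : nat -> R) m n :
  (forall n, Cmod (f n - 1) <= b n) -> (m <= n)%nat ->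
  Cmod (Cpartial_prod f n - Cpartial_prod f m) <=
    Cmod (Cpartial_prod f m) * (exp (Rpartial_sum b n - Rpartial_sum b m) - 1).
Proof.
  intros H Hmn.
  assert (E : exists p, Cpartial_prod f n = (Cpartial_prod f m * p)%C /\
     Cmod (p - 1) <= exp (Rpartial_sum b n - Rpartial_sum b m) - 1).
  { induction Hmn as [|n Hmn [p [E IH]]].
    - exists 1. split; [ring|]. rewrite Rminus_diag, exp_0.
      replace (1 - 1)%C with (RtoC 0) by ring. rewrite Cmod_0; lra.
    - exists (p * f n)%C; split; [simpl; rewrite E; ring|].
      replace (Rpartial_sum b (S n) - Rpartial_sum b m)
        with ((Rpartial_sum b n - Rpartial_sum b m) + b n) by (simpl; ring).
      apply mult_dist_1; auto.
      pose proof (H n); pose proof (exp_ineq1_le (b n)); lra. }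
  destruct E as [p [E Hp]]. rewrite E.
  replace (Cpartial_prod f m * p - Cpartial_prod f m)%C
    with (Cpartial_prod f m * (p - 1))%C by ring.
  rewrite Cmod_mult. apply Rmult_le_compat_l; auto using Cmod_ge_0.
Qed.

Lemma Cpartial_prod_bound (f : nat -> C) (b : nat -> R) n :
  (forall n, Cmod (f n - 1) <= b n) -> Cmod (Cpartial_prod f n) <= exp (Rpartial_sum b n).
Proof.
  intros H. pose proof (Cpartial_prod_dist f b 0 n H (Nat.le_0_l n)) as D. simpl in D.
  rewrite Cmod_1, Rminus_0_r in D.
  pose proof (Cmod_triangle (Cpartial_prod f n - 1) 1) as T.
  replace (Cpartial_prod f n - 1 + 1)%C with (Cpartial_prod f n) in T by ring.
  rewrite Cmod_1 in T; lra.
Qed.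

Lemma Cpartial_prod_dist_exp (f : nat -> C) (b : nat -> R) (B : R) m n :
  (forall n, Cmod (f n - 1) <= b n) -> (forall n, 0 <= b n) ->
  is_lim_seq (Rpartial_sum b) B -> (m <= n)%nat ->
  Cmod (Cpartial_prod f n - Cpartial_prod f m) <= exp B - exp (Rpartial_sum b m).
Proof.
  intros H Hb HB Hmn.
  pose proof (Cpartial_prod_dist f b m n H Hmn) as D.
  pose proof (Cpartial_prod_bound f b m H) as P.
  pose proof (Cmod_ge_0 (Cpartial_prod f m)). 
  pose proof (exp_le_compat _ _ (Rpartial_sum_le_lim b B n Hb HB)) as L.
  assert (E : exp (Rpartial_sum b n) =
    exp (Rpartial_sum b m) * exp (Rpartial_sum b n - Rpartial_sum b m)).
  { rewrite <- exp_plus; f_equal; ring. }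
  assert (0 <= exp (Rpartial_sum b n - Rpartial_sum b m) - 1).
  { clear - Hmn Hb.
    enough (exp 0 <= exp (Rpartial_sum b n - Rpartial_sum b m)) by (rewrite exp_0 in *; lra).
    apply exp_le_compat.
    induction Hmn; simpl; [lra|]. pose proof (Hb m0); lra. }
  nra.
Qed.

Lemma Cpartial_prod_cv (f : nat -> C) (b : nat -> R) (B : R) :
  (forall n, Cmod (f n - 1) <= b n) -> (forall n, 0 <= b n) ->
  is_lim_seq (Rpartial_sum b) B -> exists l, Clim (Cpartial_prod f) l.
Proof.
  intros H Hb HB.
  apply (Clim_Cauchy _ (fun m => exp B - exp (Rpartial_sum b m))).
  - now apply is_lim_seq_exp_diff.
  - intros; now apply Cpartial_prod_dist_exp.
Qed.

Lemma Cpartial_prod_lim_neq_0 (f : nat -> C) (b : nat -> R) (B : R) (l : C) :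
  (forall n, Cmod (f n - 1) <= b n) -> (forall n, 0 <= b n) ->
  is_lim_seq (Rpartial_sum b) B -> (forall n, f n <> 0) ->
  Clim (Cpartial_prod f) l -> l <> 0.
Proof.
  intros H Hb HB Hf Hl.
  assert (E : is_lim_seq (fun m => exp (B - Rpartial_sum b m)) 1).
  { replace 1 with (exp (B - B)) by (now rewrite Rminus_diag, exp_0).
    apply (is_lim_seq_continuous exp); [apply derivable_continuous_pt, derivable_pt_exp|].
    apply is_lim_seq_minus'; auto using is_lim_seq_const. }
  (* With 1/2 here, the exponential of the tail is below 3/2, so every later partial product stays
     within half the modulus of the [m]-th one. *)
  destruct (proj2 (is_lim_seq_spec _ _) E (mkposreal (1/2) ltac:(lra))) as [m Hm].
  specialize (Hm m (le_n m)). simpl in Hm. apply Rabs_lt_between in Hm.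
  assert (Pm : 0 < Cmod (Cpartial_prod f m)) by (now apply Cmod_gt_0, Cpartial_prod_neq_0).
  apply Cmod_gt_0. apply Rlt_le_trans with (Cmod (Cpartial_prod f m) / 2); [lra|].
  apply (Clim_ge (Cpartial_prod f)); auto.
  exists m; intros n Hn. pose proof (Cpartial_prod_dist f b m n H Hn) as D.
  assert (exp (Rpartial_sum b n - Rpartial_sum b m) <= exp (B - Rpartial_sum b m)).
  { apply exp_le_compat. pose proof (Rpartial_sum_le_lim b B n Hb HB); lra. }
  pose proof (Cmod_triangle (- (Cpartial_prod f n - Cpartial_prod f m)) (Cpartial_prod f n)) as T.
  replace (- (Cpartial_prod f n - Cpartial_prod f m) + Cpartial_prod f n)%C
    with (Cpartial_prod f m) in T by ring.
  rewrite Cmod_opp in T. nra.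
Qed.

Lemma pow_decr (r : R) m n : 0 <= r <= 1 -> (m <= n)%nat -> r ^ n <= r ^ m.
Proof.
  intros Hr H; induction H; [lra|]. simpl. assert (0 <= r ^ m0) by (apply pow_le; lra). nra.
Qed.

Lemma Rpartial_sum_geom r N : r <> 1 -> Rpartial_sum (fun n => r ^ n) N = (1 - r ^ N) / (1 - r).
Proof. intros; induction N; simpl; [|rewrite IHN]; field; lra. Qed.

Lemma Rpartial_sum_scal c f N : Rpartial_sum (fun n => c * f n) N = c * Rpartial_sum f N.
Proof. induction N; simpl; [|rewrite IHN]; ring. Qed.

Lemma Rpartial_sum_geom_lim c r : Rabs r < 1 ->
  is_lim_seq (Rpartial_sum (fun n => c * r ^ n)) (c * ((1 - 0) / (1 - r))).
Proof.
  intros Hr. assert (r <> 1) by (apply Rabs_lt_between in Hr; lra).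
  apply is_lim_seq_ext with (fun N => c * ((1 - r ^ N) / (1 - r))).
  - intros; now rewrite Rpartial_sum_scal, Rpartial_sum_geom.
  - apply is_lim_seq_mult'; [apply is_lim_seq_const|].
    apply is_lim_seq_mult'; [|apply is_lim_seq_const].
    apply is_lim_seq_minus'; [apply is_lim_seq_const|].
    now apply is_lim_seq_geom.
Qed.

Lemma zsumR_geom_cv K r : 0 <= r < 1 ->
  exists B, is_lim_seq (zsumR (fun n => K * r ^ Z.abs_nat n)) (Finite B).
Proof.
  intros Hr. eexists.
  apply is_lim_seq_ext with (fun N => K + Rpartial_sum (fun n => (2 * K * r) * r ^ n) N).
  - intros N. unfold zsumR. change (Z.abs_nat 0) with O. rewrite pow_O, Rmult_1_r. f_equal.
    induction N; [reflexivity|]. cbn [Rpartial_sum]. rewrite IHN. f_equal.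
    unfold zpos, zneg. rewrite Zabs2Nat.id.
    replace (Z.abs_nat (- Z.of_nat (S N))) with (S N) by lia. simpl; ring.
  - apply is_lim_seq_plus'; [apply is_lim_seq_const|].
    apply Rpartial_sum_geom_lim. apply Rabs_lt_between; lra.
Qed.

(** * Theta functions *)

Lemma Copp_neq_0 (x : C) : x <> 0 -> (- x)%C <> 0.
Proof. intros H E. apply H. replace x with (- - x)%C by ring. rewrite E; ring. Qed.

Lemma Cinv_nz (x : C) : x <> 0 -> (/ x)%C <> 0.
Proof.
  intros H. apply Cmod_gt_0. rewrite Cmod_inv by auto.
  now apply Rinv_0_lt_compat, Cmod_gt_0.
Qed.

(** * Integer powers *)

Definition zpow (x : C) (n : Z) : C :=
  if Z.leb 0 n then Cpow x (Z.to_nat n) else Cinv (Cpow x (Z.to_nat (- n))).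

Lemma zpow_of_nat (x : C) n : zpow x (Z.of_nat n) = (x ^ n)%C.
Proof. unfold zpow. rewrite (proj2 (Z.leb_le _ _)) by lia. now rewrite Nat2Z.id. Qed.

Lemma zpow_opp_nat (x : C) n : x <> 0 -> zpow x (- Z.of_nat n) = (/ x ^ n)%C.
Proof.
  intros Hx; destruct n.
  - unfold zpow; simpl. field.
  - unfold zpow. rewrite (proj2 (Z.leb_gt _ _)) by lia. now rewrite Z.opp_involutive, Nat2Z.id.
Qed.

Lemma zpow_0 (x : C) : zpow x 0 = 1.
Proof. reflexivity. Qed.

Lemma zpow_neq_0 (x : C) n : x <> 0 -> zpow x n <> 0.
Proof.
  intros Hx. unfold zpow. destruct (Z.leb 0 n); [now apply Cpow_nz|].
  now apply Cinv_nz, Cpow_nz.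
Qed.

Lemma zpow_succ (x : C) n : x <> 0 -> zpow x (n + 1) = (zpow x n * x)%C.
Proof.
  intros Hx. destruct (Z_le_gt_dec 0 n) as [H|H].
  - rewrite <- (Z2Nat.id n) by lia. replace (Z.of_nat (Z.to_nat n) + 1)%Z
      with (Z.of_nat (S (Z.to_nat n))) by lia.
    rewrite !zpow_of_nat. simpl; ring.
  - replace n with (- Z.of_nat (S (Z.to_nat (- n - 1))))%Z at 2 by lia.
    replace (n + 1)%Z with (- Z.of_nat (Z.to_nat (- n - 1)))%Z by lia.
    rewrite !zpow_opp_nat by auto. simpl. pose proof (Cpow_nz x (Z.to_nat (- n - 1)) Hx).
    field; auto.
Qed.

(** With an equivalence as its step, an identity has to be examined only under n -> n + 1, and
    negative integers come for free. *)
Lemma Z_ind_step (P : Z -> Prop) :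
  P 0%Z -> (forall n, P n <-> P (n + 1)%Z) -> forall n, P n.
Proof.
  intros H0 HS n. apply Z.peano_ind; auto.
  - intros x Hx. apply HS in Hx. now replace (Z.succ x) with (x + 1)%Z by lia.
  - intros x Hx. apply HS. now replace (Z.pred x + 1)%Z with x by lia.
Qed.

Lemma Cmult_cancel_r (a b c : C) : c <> 0 -> (a * c)%C = (b * c)%C -> a = b.
Proof.
  intros Hc E. replace a with (a * c / c)%C by (field; auto). rewrite E. field; auto.
Qed.

Lemma zpow_add (x : C) m n : x <> 0 -> zpow x (m + n) = (zpow x m * zpow x n)%C.
Proof.
  intros Hx. revert n. apply Z_ind_step.
  - rewrite Z.add_0_r, zpow_0; ring.
  - intros n. rewrite Z.add_assoc, !zpow_succ by auto. split; intros E.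
    + rewrite E; ring.
    + apply (Cmult_cancel_r _ _ x); auto. rewrite E; ring.
Qed.

Lemma zpow_1 (x : C) : zpow x 1 = x.
Proof. unfold zpow; simpl; ring. Qed.

Lemma zpow_1_l (n : Z) : zpow 1 n = 1.
Proof. unfold zpow. rewrite !Cpow_1_l. destruct (Z.leb 0 n); auto. field. Qed.

Lemma zpow_opp (x : C) n : x <> 0 -> zpow x (- n) = (/ zpow x n)%C.
Proof.
  intros Hx. pose proof (zpow_neq_0 x n Hx).
  apply (Cmult_cancel_r _ _ (zpow x n)); auto.
  rewrite <- zpow_add by auto. rewrite Z.add_opp_diag_l, zpow_0. field; auto.
Qed.

Lemma zpow_sub (x : C) m n : x <> 0 -> zpow x (m - n) = (zpow x m / zpow x n)%C.
Proof. intros Hx. unfold Z.sub. now rewrite zpow_add, zpow_opp. Qed.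

Lemma zpow_mult_l (x y : C) n : x <> 0 -> y <> 0 -> zpow (x * y) n = (zpow x n * zpow y n)%C.
Proof.
  intros Hx Hy. pose proof (Cmult_neq_0 x y Hx Hy).
  revert n. apply Z_ind_step.
  - rewrite !zpow_0; ring.
  - intros n. rewrite !zpow_succ by auto. split; intros E.
    + rewrite E; ring.
    + apply (Cmult_cancel_r _ _ (x * y)); auto. rewrite E; ring.
Qed.

Lemma zpow_mult_r (x : C) m n : x <> 0 -> zpow x (m * n) = zpow (zpow x m) n.
Proof.
  intros Hx. pose proof (zpow_neq_0 x m Hx). revert n. apply Z_ind_step.
  - now rewrite Z.mul_0_r, !zpow_0.
  - intros n. rewrite Z.mul_add_distr_l, Z.mul_1_r, zpow_add, zpow_succ by auto.
    split; intros E; [now rewrite E | now apply (Cmult_cancel_r _ _ (zpow x m))].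
Qed.

Lemma Cdiv_nz (x y : C) : x <> 0 -> y <> 0 -> (x / y)%C <> 0.
Proof. intros; apply Cmult_neq_0; auto using Cinv_nz. Qed.

Lemma Cmod_lt_1_neq_1 (z : C) : Cmod z < 1 -> (1 - z)%C <> 0.
Proof.
  intros H E. replace z with (1 - (1 - z))%C in H by ring. rewrite E in H.
  replace (1 - 0)%C with (RtoC 1) in H by ring. rewrite Cmod_1 in H; lra.
Qed.

(** * The theta series and its functional equations *)

Definition tri (n : Z) : Z := (n * (n - 1) / 2)%Z.

Lemma tri_double n : (2 * tri n = n * (n - 1))%Z.
Proof.
  unfold tri. destruct (Z.Even_or_Odd n) as [[k ->]|[k ->]].
  - replace (2 * k * (2 * k - 1))%Z with (k * (2 * k - 1) * 2)%Z by ring.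
    rewrite Z.div_mul by lia. ring.
  - replace ((2 * k + 1) * (2 * k + 1 - 1))%Z with ((2 * k + 1) * k * 2)%Z by ring.
    rewrite Z.div_mul by lia. ring.
Qed.

Lemma tri_succ n : tri (n + 1) = (tri n + n)%Z.
Proof. pose proof (tri_double n); pose proof (tri_double (n + 1)); lia. Qed.

Lemma tri_opp n : tri (- n) = (tri n + n)%Z.
Proof. pose proof (tri_double n); pose proof (tri_double (- n)); lia. Qed.

Definition theta_term (q x : C) (n : Z) : C := (zpow (- x) n * zpow q (tri n))%C.

(** In Jacobi's product form this is (q; q) (x; q) (q/x; q) with infinite q-Pochhammer symbols,
    which puts the zeros exactly at the powers of q. *)
Definition theta (q x : C) : C := Clim_val (zsum (theta_term q x)).

Lemma theta_term_succ (q x : C) n : q <> 0 -> x <> 0 ->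
  theta_term q x (n + 1) = (- x * zpow q n * theta_term q x n)%C.
Proof.
  intros Hq Hx. unfold theta_term.
  rewrite tri_succ, zpow_succ, zpow_add by auto using Copp_neq_0. ring.
Qed.

Lemma theta_term_neg (q x : C) n : q <> 0 -> x <> 0 ->
  theta_term q (q / x) n = theta_term q x (- n).
Proof.
  intros Hq Hx. unfold theta_term. rewrite tri_opp, zpow_add by auto.
  replace (- (q / x))%C with (q * / - x)%C by (field; auto using Copp_neq_0).
  rewrite zpow_mult_l, zpow_opp by auto using Copp_neq_0, Cinv_nz.
  replace (zpow (/ - x) n) with (/ zpow (- x) n)%C; [ring|].
  pose proof (zpow_neq_0 (- x) n (Copp_neq_0 x Hx)).
  apply (Cmult_cancel_r _ _ (zpow (- x) n)); auto.
  rewrite <- zpow_mult_l by auto using Copp_neq_0, Cinv_nz.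
  replace (/ - x * - x)%C with (zpow 1 1) by (rewrite zpow_1; field; auto using Copp_neq_0).
  rewrite <- zpow_mult_r, Z.mul_1_l by (intros E; injection E; lra).
  rewrite zpow_1_l. field; auto.
Qed.

(** A Gaussian sequence decays faster than any geometric one: its ratio [r ^ k * X] is at most [rho]
    from some N on, and each of the first N steps exceeds the rate [rho] by a factor at most [M],
    whence the constant [M ^ N]. *)
Lemma gauss_bound (r X rho : R) : 0 < r < 1 -> 0 < X -> 0 < rho ->
  exists K, 0 < K /\ forall v : nat -> R, v O = 1 ->
    (forall k, v (S k) = v k * (r ^ k * X)) -> forall k, 0 < v k <= K * rho ^ k.
Proof.
  intros Hr HX Hrho.
  assert (HN : exists N, forall k, (N <= k)%nat -> r ^ k * X <= rho).
  { assert (L : is_lim_seq (fun k => r ^ k) 0) by (apply is_lim_seq_geom, Rabs_lt_between; lra).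
    destruct (proj2 (is_lim_seq_spec _ _) L (mkposreal (rho / X) ltac:(apply Rdiv_lt_0_compat; lra)))
      as [N HN].
    exists N; intros k Hk. specialize (HN k Hk). simpl in HN. rewrite Rminus_0_r in HN.
    apply Rlt_le, Rle_lt_trans with (Rabs (r ^ k) * X).
    - apply Rmult_le_compat_r; [lra | apply Rle_abs].
    - replace rho with (rho / X * X) by (field; lra). apply Rmult_lt_compat_r; lra. }
  destruct HN as [N HN].
  set (M := Rmax rho X / rho).
  assert (HM : 1 <= M).
  { unfold M. apply Rmult_le_reg_r with rho; auto. field_simplify; [|lra]. apply Rmax_l. }
  exists (M ^ N); split; [apply pow_lt; lra|].
  intros v v0 vS.
  assert (E : forall k, 0 < v k /\ v k <= M ^ (min k N) * rho ^ k).
  { induction k as [|k [IH1 IH2]].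
    - rewrite v0; simpl; lra.
    - assert (P : 0 < r ^ k * X) by (apply Rmult_lt_0_compat; auto; apply pow_lt; lra).
      rewrite vS; split; [apply Rmult_lt_0_compat; auto|].
      assert (Pr : 0 < rho ^ k) by (now apply pow_lt).
      assert (PM : 0 < M ^ min k N) by (apply pow_lt; lra).
      destruct (le_lt_dec N k) as [H|H].
      + replace (min (S k) N) with (min k N) by lia. specialize (HN k H). simpl. 
        apply Rle_trans with (M ^ min k N * rho ^ k * rho); [|lra].
        apply Rmult_le_compat; lra.
      + replace (min (S k) N) with (S (min k N)) by lia. simpl.
        assert (r ^ k * X <= M * rho).
        { unfold M. replace (Rmax rho X / rho * rho) with (Rmax rho X) by (field; lra).
          apply Rle_trans with (1 * X); [|rewrite Rmult_1_l; apply Rmax_r].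
          apply Rmult_le_compat_r; [lra|]. rewrite <- (pow1 k). apply pow_incr; lra. }
        apply Rle_trans with (M ^ min k N * rho ^ k * (M * rho)); [|lra].
        apply Rmult_le_compat; lra. }
  intros k. destruct (E k) as [E1 E2]; split; auto.
  eapply Rle_trans; [apply E2|]. apply Rmult_le_compat_r; [left; now apply pow_lt|].
  apply Rle_pow; auto; lia.
Qed.

(** The terms of negative index are those of positive index at q/x, so two one-sided estimates
    suffice. The rate is left free because the product of two theta series needs a smaller one than
    convergence does. *)
Lemma theta_term_bound (q x : C) (rho : R) :
  0 < Cmod q < 1 -> x <> 0 -> 0 < rho ->
  exists K, 0 < K /\ forall n, Cmod (theta_term q x n) <= K * rho ^ Z.abs_nat n.
Proof.
  intros Hq Hx Hrho.
  assert (Hq0 : q <> 0) by (apply Cmod_gt_0; lra).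
  assert (P : forall y : C, y <> 0 -> exists K, 0 < K /\
     forall n, Cmod (theta_term q y (Z.of_nat n)) <= K * rho ^ n).
  { intros y Hy. destruct (gauss_bound (Cmod q) (Cmod y) rho) as [K [HK H]]; auto.
    - now apply Cmod_gt_0.
    - exists K; split; auto. apply (H (fun n => Cmod (theta_term q y (Z.of_nat n)))).
      + unfold theta_term. change (Z.of_nat 0) with 0%Z. change (tri 0) with 0%Z.
        rewrite !zpow_0, Cmult_1_l. apply Cmod_1.
      + intros k. replace (Z.of_nat (S k)) with (Z.of_nat k + 1)%Z by lia.
        rewrite theta_term_succ, !Cmod_mult, Cmod_opp, zpow_of_nat, Cmod_pow by auto. ring. }
  destruct (P x Hx) as [K1 [HK1 H1]].
  destruct (P (q / x)%C (Cdiv_nz _ _ Hq0 Hx)) as [K2 [HK2 H2]].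
  exists (K1 + K2); split; [lra|]. intros n.
  assert (0 < rho ^ Z.abs_nat n) by now apply pow_lt.
  destruct (Z_le_gt_dec 0 n).
  - specialize (H1 (Z.abs_nat n)). replace (Z.of_nat (Z.abs_nat n)) with n in H1 by lia. nra.
  - specialize (H2 (Z.abs_nat n)). rewrite theta_term_neg in H2 by auto.
    replace (- Z.of_nat (Z.abs_nat n))%Z with n in H2 by lia. nra.
Qed.

Lemma theta_cv (q x : C) : 0 < Cmod q < 1 -> x <> 0 ->
  Clim (zsum (theta_term q x)) (theta q x).
Proof.
  intros Hq Hx. destruct (theta_term_bound q x (1/2) Hq Hx ltac:(lra)) as [K [HK H]].
  destruct (zsumR_geom_cv K (1/2) ltac:(lra)) as [B HB].
  destruct (zsum_cv _ _ _ H HB) as [l Hl].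
  unfold theta. now rewrite (Clim_val_unique _ _ Hl).
Qed.

(** Symmetric windows are not invariant under shifts; a shift by one changes the sum by two boundary
    terms, which the geometric bound sends to 0. *)
Lemma zsum_shift_cv (f : Z -> C) (K rho : R) (l : C) (k : Z) :
  0 <= rho < 1 -> (forall n, Cmod (f n) <= K * rho ^ Z.abs_nat n) ->
  Clim (zsum f) l -> Clim (zsum (fun n => f (n + k)%Z)) l.
Proof.
  intros Hrho H.
  assert (HK : 0 <= K).
  { specialize (H 0%Z). simpl in H. pose proof (Cmod_ge_0 (f 0%Z)). lra. }
  assert (Z0 : forall (phi : nat -> Z) j, (forall n, (n <= Z.abs_nat (phi n) + j)%nat) ->
     Clim (fun N => f (phi N)) 0).
  { intros phi j Hphi.
    apply Clim_squeeze with (fun N => K * rho ^ (N - j)).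
    - replace (Finite 0) with (Finite (K * 0)) by (f_equal; ring).
      apply is_lim_seq_mult'; [apply is_lim_seq_const|].
      apply (is_lim_seq_incr_n _ j).
      apply is_lim_seq_ext with (fun n => rho ^ n); [intros; f_equal; lia|].
      apply is_lim_seq_geom, Rabs_lt_between; lra.
    - exists O; intros n _. replace (f (phi n) - 0)%C with (f (phi n)) by ring.
      eapply Rle_trans; [apply H|]. apply Rmult_le_compat_l; auto.
      apply pow_decr; [lra|]. specialize (Hphi n); lia. }
  intros Hl. revert k. apply Z_ind_step.
  - revert Hl; apply Clim_ext; intros; apply zsum_ext; intros; f_equal; lia.
  - intros k.
    assert (E : forall N, zsum (fun n => f (n + (k + 1))%Z) N =
      (zsum (fun n => f (n + k)%Z) N + (f (Z.of_nat N + 1 + k)%Z - f (- Z.of_nat N + k)%Z))%C).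
    { intros N.
      transitivity (zsum (fun n => f ((n + 1) + k)%Z) N).
      - apply zsum_ext; intros; f_equal; lia.
      - rewrite (zsum_succ (fun n => f (n + k)%Z)). ring. }
    assert (D : Clim (fun N => f (Z.of_nat N + 1 + k)%Z - f (- Z.of_nat N + k)%Z)%C (0 - 0)%C).
    { apply Clim_minus; apply (Z0 _ (S (Z.abs_nat k))); intros; lia. }
    split; intros Hk.
    + apply Clim_ext with (1 := fun N => eq_sym (E N)).
      replace l with (l + (0 - 0))%C by ring. now apply Clim_plus.
    + replace l with (l - (0 - 0))%C by ring.
      eapply Clim_ext; [|apply (Clim_minus _ _ _ _ Hk D)].
      intros N; simpl. rewrite E; ring.
Qed.

Lemma theta_q_mult (q x : C) : 0 < Cmod q < 1 -> x <> 0 ->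
  theta q (q * x) = (- theta q x / x)%C.
Proof.
  intros Hq Hx. assert (Hq0 : q <> 0) by (apply Cmod_gt_0; lra).
  destruct (theta_term_bound q x (1/2) Hq Hx ltac:(lra)) as [K [HK H]].
  pose proof (zsum_shift_cv _ K (1/2) _ 1 ltac:(lra) H (theta_cv q x Hq Hx)) as L.
  apply (Clim_scal (- / x)) in L.
  apply (Clim_unique (zsum (theta_term q (q * x)))).
  - apply theta_cv; auto using Cmult_neq_0.
  - replace (- theta q x / x)%C with (- / x * theta q x)%C by (field; auto).
    revert L; apply Clim_ext; intros N. rewrite <- zsum_scal. apply zsum_ext; intros n.
    rewrite theta_term_succ by auto. unfold theta_term.
    replace (- (q * x))%C with (q * - x)%C by ring.
    rewrite zpow_mult_l by auto using Copp_neq_0. field; auto.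
Qed.

Lemma theta_q_div (q x : C) : 0 < Cmod q < 1 -> x <> 0 -> theta q (q / x) = theta q x.
Proof.
  intros Hq Hx. assert (Hq0 : q <> 0) by (apply Cmod_gt_0; lra).
  apply (Clim_unique (zsum (theta_term q (q / x)))).
  - apply theta_cv; auto using Cdiv_nz.
  - eapply Clim_ext; [|apply (theta_cv q x); auto].
    intros N. rewrite <- zsum_opp. apply zsum_ext; intros. symmetry; now apply theta_term_neg.
Qed.

Lemma theta_inv (q x : C) : 0 < Cmod q < 1 -> x <> 0 -> theta q (/ x) = (- theta q x / x)%C.
Proof.
  intros Hq Hx.
  rewrite <- (theta_q_div q x) by auto. unfold Cdiv at 2.
  rewrite (theta_q_mult q (/ x)) by auto using Cinv_nz. field; auto using Cinv_nz.
Qed.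

(** * The Jacobi triple product *)

Definition qfac (q : C) (n : nat) : C := Cpartial_prod (fun j => 1 - q ^ S j)%C n.

Definition theta_factor (q x : C) (j : nat) : C := ((1 - x * q ^ j) * (1 - q ^ S j / x))%C.

(* [1 / (q)_m], extended by [0] to negative [m]. *)
Definition qfac_inv (q : C) (m : Z) : C :=
  if Z.leb 0 m then Cinv (qfac q (Z.to_nat m)) else RtoC 0.

(** The Gaussian binomial coefficient of 2n over n + j. The value 0 of [qfac_inv] at negative
    arguments makes it vanish for |j| > n. *)
Definition qbin (q : C) (n : nat) (j : Z) : C :=
  (qfac q (2 * n) * (qfac_inv q (Z.of_nat n - j) * qfac_inv q (Z.of_nat n + j)))%C.

Lemma Cmod_pow_lt_1 (q : C) (n : nat) : Cmod q < 1 -> Cmod (q ^ S n) < 1.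
Proof.
  intros Hq. rewrite Cmod_pow. apply pow_lt_1_compat; [|lia]. split; auto using Cmod_ge_0.
Qed.

Lemma qfac_neq_0 (q : C) n : Cmod q < 1 -> qfac q n <> 0.
Proof.
  intros Hq. apply Cpartial_prod_neq_0; intros j.
  now apply Cmod_lt_1_neq_1, Cmod_pow_lt_1.
Qed.

(** At m = 0 the factor 1 - q^0 = 0 agrees with the extension by 0, so the recursion holds on all of
    Z and the boundary of the binomial range needs no separate treatment. *)
Lemma qfac_inv_pred (q : C) m : 0 < Cmod q < 1 ->
  qfac_inv q (m - 1) = ((1 - zpow q m) * qfac_inv q m)%C.
Proof.
  intros Hq. unfold qfac_inv. destruct (Z.leb_spec 0 m) as [H|H].
  - destruct (Z.leb_spec 0 (m - 1)) as [H1|H1].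
    + replace (Z.to_nat m) with (S (Z.to_nat (m - 1))) by lia.
      replace m with (Z.of_nat (S (Z.to_nat (m - 1)))) at 2 by lia.
      rewrite zpow_of_nat. unfold qfac; cbn [Cpartial_prod]. fold (qfac q (Z.to_nat (m - 1))).
      pose proof (qfac_neq_0 q (Z.to_nat (m - 1)) ltac:(lra)).
      pose proof (Cmod_lt_1_neq_1 _ (Cmod_pow_lt_1 q (Z.to_nat (m - 1)) ltac:(lra))).
      field; auto.
    + replace m with 0%Z by lia. rewrite zpow_0. ring.
  - destruct (Z.leb_spec 0 (m - 1)); [lia | ring].
Qed.

Lemma qfac_inv_neg (q : C) m : (m < 0)%Z -> qfac_inv q m = 0.
Proof. intros H. unfold qfac_inv. destruct (Z.leb_spec 0 m); [lia | auto]. Qed.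

(** Two Pascal steps at once. The coefficients are those of [theta_factor q x n], which expands to 1
    + q^(2n+1) - x q^n - q^(n+1)/x; the powers of q^j come from the ratios of consecutive theta
    terms. *)
Lemma qbin_S (q : C) n j : 0 < Cmod q < 1 ->
  qbin q (S n) j =
    ((1 + q ^ n * q ^ n * q) * qbin q n j
     + q ^ n * q / zpow q j * qbin q n (j - 1) + q ^ n * q * zpow q j * qbin q n (j + 1))%C.
Proof.
  intros Hq. assert (Hq0 : q <> 0) by (apply Cmod_gt_0; lra).
  unfold qbin.
  replace (2 * S n)%nat with (S (S (2 * n))) by lia. unfold qfac at 1; cbn [Cpartial_prod].
  fold (qfac q (2 * n)).
  set (a := (Z.of_nat (S n) - j)%Z). set (b := (Z.of_nat (S n) + j)%Z).
  replace (Z.of_nat n - j)%Z with (a - 1)%Z by (unfold a; lia).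
  replace (Z.of_nat n + j)%Z with (b - 1)%Z by (unfold b; lia).
  replace (Z.of_nat n - (j - 1))%Z with a by (unfold a; lia).
  replace (Z.of_nat n + (j - 1))%Z with (b - 1 - 1)%Z by (unfold b; lia).
  replace (Z.of_nat n - (j + 1))%Z with (a - 1 - 1)%Z by (unfold a; lia).
  replace (Z.of_nat n + (j + 1))%Z with b by (unfold b; lia).
  rewrite !qfac_inv_pred by auto.
  rewrite !(zpow_sub q _ 1), !zpow_1 by auto.
  assert (Ea : zpow q a = (q ^ n * q / zpow q j)%C).
  { unfold a. rewrite zpow_sub, zpow_of_nat by auto. simpl; unfold Cdiv; ring. }
  assert (Eb : zpow q b = (q ^ n * q * zpow q j)%C).
  { unfold b. rewrite zpow_add, zpow_of_nat by auto. simpl; ring. }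
  rewrite Ea, Eb.
  replace (q ^ S (2 * n))%C with (q ^ n * q ^ n * q)%C.
  2: { replace (S (2 * n)) with (n + n + 1)%nat by lia. rewrite !Cpow_add_r, Cpow_1_r; auto. }
  replace (q ^ S (S (2 * n)))%C with (q ^ n * q ^ n * q * q)%C.
  2: { replace (S (S (2 * n))) with (n + n + 1 + 1)%nat by lia.
       rewrite !Cpow_add_r, Cpow_1_r; auto. }
  pose proof (zpow_neq_0 q j Hq0). generalize (qfac q (2 * n)), (qfac_inv q a), (qfac_inv q b).
  intros. field; auto.
Qed.

(** The finite triple product, by induction on n through [qbin_S]. The window N may be any size from
    n on, since all further summands are 0; this is what lets N and n go to infinity one after the
    other. *)
Lemma theta_fin (q x : C) n N : 0 < Cmod q < 1 -> x <> 0 -> (n <= N)%nat ->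
  zsum (fun j => theta_term q x j * qbin q n j)%C N = Cpartial_prod (theta_factor q x) n.
Proof.
  intros Hq Hx. assert (Hq0 : q <> 0) by (apply Cmod_gt_0; lra).
  assert (Z0 : forall n j, (Z.of_nat n < Z.abs j)%Z -> qbin q n j = 0).
  { intros m j Hj. unfold qbin. destruct (Z_le_gt_dec 0 j).
    - rewrite (qfac_inv_neg q (Z.of_nat m - j)) by lia. ring.
    - rewrite (qfac_inv_neg q (Z.of_nat m + j)) by lia. ring. }
  revert N; induction n as [|n IH]; intros N HN.
  - induction N as [|N IHN].
    + rewrite zsum_0. unfold theta_term, qbin, qfac_inv, qfac; simpl.
      rewrite !zpow_0. field.
    + rewrite zsum_S, IHN by lia. rewrite !Z0 by (unfold zpos, zneg; lia). ring.
  - set (F := fun j => (theta_term q x j * qbin q n j)%C) in *.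
    transitivity (zsum (fun j => (1 + q ^ n * q ^ n * q) * F j
       + ((- (x * q ^ n)) * F (j - 1)%Z + (- (q ^ n * q / x)) * F (j + 1)%Z))%C N).
    + apply zsum_ext; intros j. unfold F. rewrite qbin_S by auto.
      rewrite (theta_term_succ q x j) by auto.
      pose proof (theta_term_succ q x (j - 1) Hq0 Hx) as E.
      replace (j - 1 + 1)%Z with j in E by lia. rewrite E.
      rewrite (zpow_sub q j 1), zpow_1 by auto. pose proof (zpow_neq_0 q j Hq0). field; auto.
    + rewrite !zsum_plus, !zsum_scal, zsum_succ.
      pose proof (zsum_succ (fun j => F (j - 1)%Z) N) as E. cbv beta in E.
      rewrite (zsum_ext (fun n0 => F (n0 + 1 - 1)%Z) F) in E by (intros; f_equal; lia).
      assert (F0 : forall j, (Z.of_nat n < Z.abs j)%Z -> F j = 0).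
      { intros j Hj. unfold F. rewrite Z0 by auto. ring. }
      (* The window exceeds n strictly here, so [F] already vanishes at the edge N and both shifts
         leave the sum unchanged. *)
      rewrite (F0 (Z.of_nat N + 1 - 1)%Z), (F0 (- Z.of_nat N - 1)%Z) in E by lia.
      rewrite (F0 (Z.of_nat N + 1)%Z), (F0 (- Z.of_nat N)%Z) by lia.
      replace (zsum (fun j => F (j - 1)%Z) N) with (zsum F N) by (rewrite E; ring).
      rewrite IH by lia. cbn [Cpartial_prod]. unfold theta_factor; cbn [Cpow]. field; auto.
Qed.

Lemma qfac_cv (q : C) : Cmod q < 1 -> exists l, Clim (qfac q) l /\ l <> 0.
Proof.
  intros Hq. pose proof (Cmod_ge_0 q).
  assert (H1 : forall n, Cmod ((1 - q ^ S n) - 1) <= 1 * Cmod q ^ n).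
  { intros n. replace (1 - q ^ S n - 1)%C with (- q ^ S n)%C by ring.
    rewrite Cmod_opp, Cmod_pow. simpl. assert (0 <= Cmod q ^ n) by now apply pow_le. nra. }
  assert (H2 : forall n, 0 <= 1 * Cmod q ^ n).
  { intros n. rewrite Rmult_1_l. now apply pow_le. }
  pose proof (Rpartial_sum_geom_lim 1 (Cmod q) ltac:(rewrite Rabs_pos_eq; auto)) as H3.
  destruct (Cpartial_prod_cv _ _ _ H1 H2 H3) as [l Hl].
  exists l; split; auto.
  apply (Cpartial_prod_lim_neq_0 _ _ _ l H1 H2 H3); auto.
  intros n. now apply Cmod_lt_1_neq_1, Cmod_pow_lt_1.
Qed.

Lemma filterlim_eventually_intro (phi : nat -> nat) :
  (forall N, exists M, forall n, (M <= n)%nat -> (N <= phi n)%nat) ->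
  filterlim phi eventually eventually.
Proof.
  intros H P [N HN]. destruct (H N) as [M HM]. exists M; intros n Hn. apply HN, HM, Hn.
Qed.

(** Tannery's theorem for [theta_fin]: the binomials are bounded uniformly in n and j, and the theta
    terms provide the summable majorant. Here l is the infinite product of the 1 - q^(j+1). *)
Lemma theta_product (q x l : C) : 0 < Cmod q < 1 -> x <> 0 -> Clim (qfac q) l -> l <> 0 ->
  Clim (Cpartial_prod (theta_factor q x)) (theta q x / l)%C.
Proof.
  intros Hq Hx Hl Hl0.
  assert (Hi : Clim (fun n => / qfac q n)%C (/ l)%C) by now apply Clim_inv.
  destruct (Clim_bounded _ _ Hl) as [K1 [HK1 H1]].
  destruct (Clim_bounded _ _ Hi) as [K2 [HK2 H2]].
  destruct (theta_term_bound q x (1/2) Hq Hx ltac:(lra)) as [K [HK H]].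
  assert (H2' : forall m, Cmod (qfac_inv q m) <= K2).
  { intros m. unfold qfac_inv. destruct (Z.leb 0 m); [apply H2 | rewrite Cmod_0; lra]. }
  assert (Hb : forall n j, Cmod (qbin q n j) <= K1 * (K2 * K2)).
  { intros n j. unfold qbin. rewrite !Cmod_mult.
    repeat apply Rmult_le_compat; auto using Cmod_ge_0, Rmult_le_pos. }
  set (K' := K * (K1 * (K2 * K2))).
  destruct (zsumR_geom_cv K' (1/2) ltac:(lra)) as [B HB].
  assert (HF : forall n j, Cmod (theta_term q x j * qbin q n j) <= K' * (1/2) ^ Z.abs_nat j).
  { intros n j. rewrite Cmod_mult. unfold K'.
    replace (K * (K1 * (K2 * K2)) * (1 / 2) ^ Z.abs_nat j)
      with (K * (1 / 2) ^ Z.abs_nat j * (K1 * (K2 * K2))) by ring.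
    apply Rmult_le_compat; auto using Cmod_ge_0. }
  apply (Clim_exchange (fun k n => zsum (fun j => theta_term q x j * qbin q k j)%C n) _
     (fun n => / l * zsum (theta_term q x) n)%C _ (fun m => B - zsumR (fun j => K' * (1/2) ^ Z.abs_nat j) m)).
  - intros k. eapply Clim_ext_loc; [|apply Clim_const].
    exists k; intros n Hn. symmetry; now apply theta_fin.
  - intros n. rewrite <- zsum_scal. apply Clim_zsum. intros j.
    (* The three q-factorials of the binomial tend to l, 1/l and 1/l; their product 1/l is written
       in this form so that each limit is taken separately. *)
    replace (/ l * theta_term q x j)%C with (theta_term q x j * (l * (/ l * / l)))%C
      by (field; auto).
    apply Clim_scal. unfold qbin.
    assert (G : forall phi : nat -> Z, (forall n, (n <= Z.to_nat (phi n) + Z.abs_nat j)%nat) ->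
       Clim (fun k => qfac_inv q (phi k)) (/ l)%C).
    { intros phi Hphi.
      apply Clim_ext_loc with (fun k => / qfac q (Z.to_nat (phi k)))%C.
      - exists (S (Z.abs_nat j)); intros k Hk. unfold qfac_inv.
        destruct (Z.leb_spec 0 (phi k)); auto. specialize (Hphi k); lia.
      - apply (Clim_subseq (fun n => / qfac q n)%C); auto.
        apply filterlim_eventually_intro. intros N; exists (N + Z.abs_nat j)%nat.
        intros k Hk. specialize (Hphi k); lia. }
    apply Clim_mult; [|apply Clim_mult].
    + apply (Clim_subseq (qfac q)); auto.
      apply filterlim_eventually_intro. intros N; exists N; intros; lia.
    + apply G; intros; lia.
    + apply G; intros; lia.
  - replace (theta q x / l)%C with (/ l * theta q x)%C by (unfold Cdiv; ring).
    now apply Clim_scal, theta_cv.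
  - replace (Finite 0) with (Finite (B - B)) by (f_equal; ring).
    apply is_lim_seq_minus'; auto using is_lim_seq_const.
  - intros k m n Hmn.
    eapply Rle_trans; [apply zsum_dist with (b := fun j => K' * (1/2) ^ Z.abs_nat j); auto|].
    apply Rplus_le_compat_r, zsumR_le_lim; auto.
    intros j; eapply Rle_trans; [apply Cmod_ge_0 | apply (HF O)].
Qed.

(** Read off from the product: no factor vanishes, and the distances of the factors from 1 are
    dominated by a geometric series. *)
Lemma theta_neq_0 (q x : C) : 0 < Cmod q < 1 -> x <> 0 ->
  (forall n, (x * zpow q n)%C <> 1) -> theta q x <> 0.
Proof.
  intros Hq Hx Hn E. assert (Hq0 : q <> 0) by (apply Cmod_gt_0; lra).
  destruct (qfac_cv q ltac:(lra)) as [l [Hl Hl0]].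
  pose proof (theta_product q x l Hq Hx Hl Hl0) as L.
  assert (Px : 0 < Cmod x) by now apply Cmod_gt_0.
  set (c := Cmod x + (1 + Cmod (q / x))).
  assert (H1 : forall n, Cmod (theta_factor q x n - 1) <= c * Cmod q ^ n).
  { intros n. unfold theta_factor. simpl.
    replace ((1 - x * q ^ n) * (1 - q * q ^ n / x) - 1)%C
      with (q ^ n * (- x + (q * q ^ n + - (q / x))))%C by (field; auto).
    rewrite Cmod_mult, Cmod_pow, Rmult_comm. apply Rmult_le_compat_r; [apply pow_le; lra|].
    eapply Rle_trans; [apply Cmod_triangle|]. rewrite Cmod_opp. apply Rplus_le_compat_l.
    eapply Rle_trans; [apply Cmod_triangle|]. rewrite Cmod_opp. apply Rplus_le_compat_r.
    change (q * q ^ n)%C with (q ^ S n)%C. left; apply Cmod_pow_lt_1; lra. }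
  assert (H2 : forall n, 0 <= c * Cmod q ^ n).
  { intros n. eapply Rle_trans; [apply Cmod_ge_0 | apply H1]. }
  pose proof (Rpartial_sum_geom_lim c (Cmod q) ltac:(rewrite Rabs_pos_eq; lra)) as H3.
  apply (Cpartial_prod_lim_neq_0 _ _ _ (theta q x / l)%C H1 H2 H3); auto.
  2: { rewrite E; field; auto. }
  intros n. unfold theta_factor. apply Cmult_neq_0; intros E1.
  - apply (Hn (Z.of_nat n)). rewrite zpow_of_nat.
    replace (x * q ^ n)%C with (1 - (1 - x * q ^ n))%C by ring. rewrite E1; ring.
  - apply (Hn (- Z.of_nat (S n))%Z). rewrite zpow_opp_nat by auto.
    assert (E2 : (q ^ S n)%C = x).
    { replace (q ^ S n)%C with (x - x * (1 - q ^ S n / x))%C by (field; auto). rewrite E1; ring. }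
    rewrite E2. field; auto.
Qed.

(** * Weierstrass' three-term relation *)

(** The variables x and y are separated: under the substitution in the indices, the quadratic
    exponents of q add up to a function of k plus a function of l. With A(x) = theta(q^2, -x^2) and
    B(x) = theta(q^2, -q x^2), the product times y is the 2 by 2 determinant of (A(x), x B(x)) and
    (A(y), y B(y)). *)
Lemma theta_mul_theta (q x y : C) : 0 < Cmod q < 1 -> x <> 0 -> y <> 0 ->
  (theta q (x * y) * theta q (x / y) =
   theta (q * q) (- (x * x)) * theta (q * q) (- (q * (y * y)))
   - x / y * theta (q * q) (- (q * (x * x))) * theta (q * q) (- (y * y)))%C.
Proof.
  intros Hq Hx Hy. assert (Hq0 : q <> 0) by (apply Cmod_gt_0; lra).
  assert (Hqq : 0 < Cmod (q * q) < 1) by (rewrite Cmod_mult; nra).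
  assert (Hxy : (x * y)%C <> 0) by auto using Cmult_neq_0.
  assert (Hxdy : (x / y)%C <> 0) by auto using Cdiv_nz.
  assert (Hnx : (- (x * x))%C <> 0) by auto using Cmult_neq_0, Copp_neq_0.
  assert (Hny : (- (y * y))%C <> 0) by auto using Cmult_neq_0, Copp_neq_0.
  assert (Hnqx : (- (q * (x * x)))%C <> 0) by auto using Cmult_neq_0, Copp_neq_0.
  assert (Hnqy : (- (q * (y * y)))%C <> 0) by auto using Cmult_neq_0, Copp_neq_0.
  (* The rate is 1/4 = (1/2)^2 because 2|m| + 2|s - m| >= |m| + |s|: half of the decay is spent on
     turning the bound in m and s - m into a product of weights in m and in s. *)
  destruct (theta_term_bound q (x * y) (1/4) Hq Hxy ltac:(lra)) as [K1 [HK1 H1]].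
  destruct (theta_term_bound q (x / y) (1/4) Hq Hxdy ltac:(lra)) as [K2 [HK2 H2]].
  set (f := fun m s => (theta_term q (x * y) m * theta_term q (x / y) (s - m))%C).
  assert (Hf : forall m s, Cmod (f m s) <= (K1 * (1/2) ^ Z.abs_nat m) * (K2 * (1/2) ^ Z.abs_nat s)).
  { intros m s. unfold f. rewrite Cmod_mult.
    apply Rle_trans with ((K1 * (1/4) ^ Z.abs_nat m) * (K2 * (1/4) ^ Z.abs_nat (s - m))).
    - apply Rmult_le_compat; auto using Cmod_ge_0.
    - replace (1 / 4) with ((1 / 2) ^ 2) by field. rewrite <- !pow_mult.
      replace (K1 * (1 / 2) ^ (2 * Z.abs_nat m) * (K2 * (1 / 2) ^ (2 * Z.abs_nat (s - m))))
        with (K1 * K2 * (1 / 2) ^ (2 * Z.abs_nat m + 2 * Z.abs_nat (s - m)))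
        by (rewrite pow_add; ring).
      replace (K1 * (1 / 2) ^ Z.abs_nat m * (K2 * (1 / 2) ^ Z.abs_nat s))
        with (K1 * K2 * (1 / 2) ^ (Z.abs_nat m + Z.abs_nat s)) by (rewrite pow_add; ring).
      apply Rmult_le_compat_l; [nra|].
      apply pow_decr; [lra | lia]. }
  destruct (zsumR_geom_cv K1 (1/2) ltac:(lra)) as [B1 HB1].
  destruct (zsumR_geom_cv K2 (1/2) ltac:(lra)) as [B2 HB2].
  assert (P1 : forall m, 0 <= K1 * (1/2) ^ Z.abs_nat m)
    by (intros; apply Rmult_le_pos; [lra | apply pow_le; lra]).
  assert (P2 : forall m, 0 <= K2 * (1/2) ^ Z.abs_nat m)
    by (intros; apply Rmult_le_pos; [lra | apply pow_le; lra]).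
  assert (Hr : forall m, Clim (zsum (f m)) (theta_term q (x * y) m * theta q (x / y))%C).
  { intros m. eapply Clim_ext; [intros N; symmetry; apply zsum_scal|]. apply Clim_scal.
    apply (zsum_shift_cv (theta_term q (x / y)) K2 (1/4) _ (- m)%Z); auto; try lra.
    now apply theta_cv. }
  set (cc := fun s => Clim_val (zsum (fun m => f m s))).
  assert (Hc : forall s, Clim (zsum (fun m => f m s)) (cc s)).
  { intros s. destruct (zsum_cv (fun m => f m s)
      (fun m => (K2 * (1/2) ^ Z.abs_nat s) * (K1 * (1/2) ^ Z.abs_nat m))
      ((K2 * (1/2) ^ Z.abs_nat s) * B1)) as [l Hl].
    - intros m. specialize (Hf m s). lra.
    - apply is_lim_seq_ext with (fun N => K2 * (1/2) ^ Z.abs_nat s *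
         zsumR (fun m => K1 * (1/2) ^ Z.abs_nat m) N); [intros; now rewrite (zsumR_scal (K2 * (1 / 2) ^ Z.abs_nat s))|].
      apply is_lim_seq_mult'; auto using is_lim_seq_const.
    - unfold cc. now rewrite (Clim_val_unique _ _ Hl). }
  assert (Hcb : forall s, Cmod (cc s) <= (B1 * K2) * (1/2) ^ Z.abs_nat s).
  { intros s. apply (Clim_le (zsum (fun m => f m s))); auto. exists O; intros N _.
    eapply Rle_trans; [apply (zsum_bound _ (fun m => (K2 * (1/2) ^ Z.abs_nat s) * (K1 * (1/2) ^ Z.abs_nat m)))|].
    - intros m. specialize (Hf m s). lra.
    - rewrite (zsumR_scal (K2 * (1 / 2) ^ Z.abs_nat s)).
      pose proof (zsumR_le_lim _ B1 N P1 HB1). specialize (P2 s). nra. }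
  destruct (zsumR_geom_cv (B1 * K2) (1/2) ltac:(lra)) as [B3 HB3].
  destruct (zsum_cv cc _ B3 Hcb HB3) as [L HL].
  (* [f m s] is the product of the [m]-th and the [(s - m)]-th term: sum first over [s], then first
     over [m], separating even [s = 2 k] and odd [s = 2 k + 1] with [m = l + k] or [l + k + 1]. *)
  assert (E1 : (theta q (x * y) * theta q (x / y))%C = L).
  { apply (Clim_unique (zsum (fun m => theta_term q (x * y) m * theta q (x / y))%C)).
    - eapply Clim_ext; [|apply Clim_mult; [apply theta_cv; auto | apply Clim_const]].
      intros N; cbv beta. rewrite (Cmult_comm (zsum _ N)), <- zsum_scal. apply zsum_ext; intros; ring.
    - apply (zsum_exchange f _ _ B1 B2 _ cc L P1 P2); auto. }
  assert (Ev : forall k, cc (2 * k)%Z =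
     (theta_term (q * q) (- (x * x)) k * theta (q * q) (- (q * (y * y))))%C).
  { intros k. apply (Clim_unique (zsum (fun l => f (l + k)%Z (2 * k)%Z))).
    - apply (zsum_shift_cv (fun m => f m (2 * k)%Z) (K1 * (K2 * (1/2) ^ Z.abs_nat (2 * k))) (1/2));
        auto; try lra.
      intros m. specialize (Hf m (2 * k)%Z). lra.
    - eapply Clim_ext; [|apply Clim_scal, theta_cv; auto].
      intros N; cbv beta. rewrite <- zsum_scal. apply zsum_ext; intros l. symmetry. unfold f, theta_term.
      replace (- - (x * x))%C with (x * x)%C by ring.
      replace (- - (q * (y * y)))%C with (q * (y * y))%C by ring.
      replace (- (x * y))%C with ((-1) * x * y)%C by ring.
      replace (- (x / y))%C with ((-1) * x * / y)%C by (unfold Cdiv; ring).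
      replace (2 * k - (l + k))%Z with (k - l)%Z by ring.
      assert (Hm1 : RtoC (-1) <> 0) by (intros E; injection E; lra).
      assert (Hmx : (-1 * x)%C <> 0) by auto using Cmult_neq_0.
      rewrite !(zpow_mult_l _ _ _) by auto using Cmult_neq_0, Cinv_nz.
      transitivity (zpow (-1) (l + k) * zpow (-1) (k - l) * (zpow x (l + k) * zpow x (k - l))
         * (zpow y (l + k) * zpow (/ y) (k - l)) * (zpow q (tri (l + k)) * zpow q (tri (k - l))))%C;
        [ring|].
      rewrite <- !zpow_add by auto.
      replace (l + k + (k - l))%Z with (2 * k)%Z by ring.
      replace (tri (l + k) + tri (k - l))%Z with (tri k + tri k + (tri l + tri l + l))%Z
        by (pose proof (tri_double (l + k)); pose proof (tri_double (k - l));
            pose proof (tri_double k); pose proof (tri_double l); lia).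
      replace (/ y)%C with (zpow y (-1)) by (change (-1)%Z with (- (1))%Z; rewrite zpow_opp, zpow_1; auto).
      rewrite <- zpow_mult_r, <- zpow_add by auto.
      replace (l + k + -1 * (k - l))%Z with (2 * l)%Z by ring.
      rewrite (zpow_mult_r (-1) 2 k) by auto.
      replace (zpow (-1) 2) with (RtoC 1) by (unfold zpow; simpl; ring).
      rewrite zpow_1_l.
      replace (2 * k)%Z with (k + k)%Z by ring. replace (2 * l)%Z with (l + l)%Z by ring.
      rewrite !zpow_add by auto. ring. }
  assert (Od : forall k, cc (2 * k + 1)%Z =
     (- (x / y) * (theta_term (q * q) (- (q * (x * x))) k * theta (q * q) (- (y * y))))%C).
  { intros k. apply (Clim_unique (zsum (fun l => f (l + (k + 1))%Z (2 * k + 1)%Z))).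
    - apply (zsum_shift_cv (fun m => f m (2 * k + 1)%Z)
        (K1 * (K2 * (1/2) ^ Z.abs_nat (2 * k + 1))) (1/2)); auto; try lra.
      intros m. specialize (Hf m (2 * k + 1)%Z). lra.
    (* For odd s the inner sum comes out as theta at q^2 times -y^2; quasi-periodicity brings it
       back to -y^2. *)
    - pose proof (theta_q_mult (q * q) (- (y * y)) Hqq Hny) as T.
      replace (- (x / y) * (theta_term (q * q) (- (q * (x * x))) k * theta (q * q) (- (y * y))))%C
        with (- (x * y) * theta_term (q * q) (- (q * (x * x))) k * theta (q * q) (q * q * - (y * y)))%C
        by (rewrite T; field; auto).
      eapply Clim_ext; [|apply Clim_scal, theta_cv; auto using Cmult_neq_0].
      intros N; cbv beta. rewrite <- zsum_scal. apply zsum_ext; intros l. symmetry. unfold f, theta_term.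
      replace (- (q * q * - (y * y)))%C with (q * q * (y * y))%C by ring.
      replace (- - (q * (x * x)))%C with (q * (x * x))%C by ring.
      replace (- (x * y))%C with ((-1) * x * y)%C by ring.
      replace (- (x / y))%C with ((-1) * x * / y)%C by (unfold Cdiv; ring).
      replace (2 * k + 1 - (l + (k + 1)))%Z with (k - l)%Z by ring.
      assert (Hm1 : RtoC (-1) <> 0) by (intros E; injection E; lra).
      assert (Hmx : (-1 * x)%C <> 0) by auto using Cmult_neq_0.
      rewrite !(zpow_mult_l _ _ _) by auto using Cmult_neq_0, Cinv_nz.
      transitivity (zpow (-1) (l + (k + 1)) * zpow (-1) (k - l) *
         (zpow x (l + (k + 1)) * zpow x (k - l))
         * (zpow y (l + (k + 1)) * zpow (/ y) (k - l))
         * (zpow q (tri (l + (k + 1))) * zpow q (tri (k - l))))%C;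
        [ring|].
      rewrite <- !zpow_add by auto.
      replace (l + (k + 1) + (k - l))%Z with (2 * k + 1)%Z by ring.
      replace (tri (l + (k + 1)) + tri (k - l))%Z with (k + (tri k + tri k) + (tri l + tri l + l + l))%Z
        by (pose proof (tri_double (l + (k + 1))); pose proof (tri_double (k - l));
            pose proof (tri_double k); pose proof (tri_double l); lia).
      replace (/ y)%C with (zpow y (-1)) by (change (-1)%Z with (- (1))%Z; rewrite zpow_opp, zpow_1; auto).
      rewrite <- zpow_mult_r, <- zpow_add by auto.
      replace (l + (k + 1) + -1 * (k - l))%Z with (2 * l + 1)%Z by ring.
      rewrite (zpow_add (-1) (2 * k) 1), (zpow_mult_r (-1) 2 k), zpow_1 by auto.
      replace (zpow (-1) 2) with (RtoC 1) by (unfold zpow; simpl; ring).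
      rewrite zpow_1_l.
      replace (2 * k)%Z with (k + k)%Z by ring. replace (2 * l)%Z with (l + l)%Z by ring.
      rewrite !zpow_add, !zpow_1 by auto. ring. }
  (* The extra summand is the odd term by which the two windows of [zsum_even_odd] differ; it tends
     to 0. *)
  rewrite E1. apply (Clim_unique (fun N => zsum cc (2 * N) + cc (2 * Z.of_nat N + 1)%Z)%C).
  - replace L with (L + 0)%C by ring. apply Clim_plus.
    + apply (Clim_subseq (zsum cc)); auto.
      apply filterlim_eventually_intro. intros N; exists N; intros; lia.
    + apply Clim_squeeze with (fun N => (B1 * K2) * (1/2) ^ N).
      * replace (Finite 0) with (Finite (B1 * K2 * 0)) by (f_equal; ring).
        apply is_lim_seq_mult'; [apply is_lim_seq_const|].
        apply is_lim_seq_geom, Rabs_lt_between; lra.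
      * exists O; intros N _. replace (cc (2 * Z.of_nat N + 1)%Z - 0)%C
          with (cc (2 * Z.of_nat N + 1)%Z) by ring.
        eapply Rle_trans; [apply Hcb|].
        assert (PB : 0 <= B1 * K2).
        { specialize (Hcb 0%Z). simpl in Hcb. pose proof (Cmod_ge_0 (cc 0%Z)). lra. }
        apply Rmult_le_compat_l; auto.
        apply pow_decr; [lra | lia].
  - eapply Clim_ext; [intros N; apply zsum_even_odd|].
    unfold Cminus. apply Clim_plus.
    + eapply Clim_ext; [|apply Clim_mult; [apply (theta_cv (q * q) (- (x * x))); auto | apply Clim_const]].
      intros N; cbv beta. rewrite (Cmult_comm (zsum _ N)), <- zsum_scal. apply zsum_ext; intros k. rewrite Ev; ring.
    + replace (- (x / y * theta (q * q) (- (q * (x * x))) * theta (q * q) (- (y * y))))%C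
        with (- (x / y) * theta (q * q) (- (y * y)) * theta (q * q) (- (q * (x * x))))%C by ring.
      eapply Clim_ext; [|apply Clim_scal, theta_cv; auto].
      intros N; cbv beta. rewrite <- zsum_scal. apply zsum_ext; intros k. rewrite Od; ring.
Qed.

(** Once each pair is a 2 by 2 determinant, this is the Plücker relation between four vectors of the
    plane, divided by w. *)
Lemma theta_three_term (q x y z w : C) :
  0 < Cmod q < 1 -> x <> 0 -> y <> 0 -> z <> 0 -> w <> 0 ->
  (y * (theta q (x * y) * theta q (x / y)) * (theta q (z * w) * theta q (z / w))
   - z * (theta q (x * z) * theta q (x / z)) * (theta q (y * w) * theta q (y / w))
   + z * (theta q (x * w) * theta q (x / w)) * (theta q (y * z) * theta q (y / z)))%C = 0.
Proof.
  intros Hq Hx Hy Hz Hw. rewrite !theta_mul_theta by auto. field; auto.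
Qed.

(** * Euler's product for the sine *)

Lemma Cexp_add (z w : C) : Cexp (z + w) = (Cexp z * Cexp w)%C.
Proof.
  destruct z as [a b], w as [c d]. unfold Cexp, Cmult, Cplus, Re, Im; simpl.
  rewrite exp_plus, cos_plus, sin_plus. f_equal; ring.
Qed.

Lemma Cexp_0 : Cexp 0 = 1.
Proof. unfold Cexp; simpl. rewrite exp_0, cos_0, sin_0. unfold RtoC; f_equal; ring. Qed.

Lemma Cmod_Cexp (z : C) : Cmod (Cexp z) = exp (Re z).
Proof.
  unfold Cexp, Cmod; simpl fst; simpl snd.
  transitivity (sqrt (exp (Re z) ^ 2)).
  - f_equal. pose proof (sin2_cos2 (Im z)) as H. unfold Rsqr in H.
    transitivity (exp (Re z) ^ 2 * (sin (Im z) * sin (Im z) + cos (Im z) * cos (Im z)));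
      [ring | rewrite H; ring].
  - apply sqrt_pow2; left; apply exp_pos.
Qed.

Lemma Cexp_neq_0 (z : C) : Cexp z <> 0.
Proof. apply Cmod_gt_0. rewrite Cmod_Cexp. apply exp_pos. Qed.

Lemma Cexp_opp (z : C) : Cexp (- z) = (/ Cexp z)%C.
Proof.
  pose proof (Cexp_neq_0 z). apply (Cmult_cancel_r _ _ (Cexp z)); auto.
  rewrite <- Cexp_add. replace (- z + z)%C with (RtoC 0) by ring. rewrite Cexp_0. field; auto.
Qed.

Definition csin (w : C) : C := ((Cexp (Ci * w) - Cexp (- (Ci * w))) / (2 * Ci))%C.
Definition ccos (w : C) : C := ((Cexp (Ci * w) + Cexp (- (Ci * w))) / 2)%C.

Lemma Ci_neq_0 : Ci <> 0.
Proof. intros E; injection E; lra. Qed.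

Lemma C2_neq_0 : RtoC 2 <> 0.
Proof. intros E; injection E; lra. Qed.

Lemma Ci_sqr : (Ci * Ci)%C = (-1)%C.
Proof. unfold Ci, Cmult, RtoC, Copp; simpl; f_equal; ring. Qed.

Lemma csin_double (w : C) : csin (2 * w) = (2 * csin w * ccos w)%C.
Proof.
  unfold csin, ccos. rewrite !Cexp_opp.
  replace (Ci * (2 * w))%C with (Ci * w + Ci * w)%C by ring. rewrite Cexp_add.
  pose proof (Cexp_neq_0 (Ci * w)). field. repeat split; auto using Ci_neq_0, C2_neq_0.
Qed.

Lemma csin2_ccos2 (w : C) : (csin w * csin w + ccos w * ccos w)%C = 1.
Proof.
  unfold csin, ccos. rewrite !Cexp_opp. set (x := Cexp (Ci * w)).
  assert (x <> 0) by apply Cexp_neq_0.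
  transitivity ((x - / x) * (x - / x) / (4 * (Ci * Ci)) + (x + / x) * (x + / x) / 4)%C.
  - field. repeat split; auto using Ci_neq_0, C2_neq_0; intros E; injection E; lra.
  - rewrite Ci_sqr. field. repeat split; auto; intros E; injection E; lra.
Qed.

Lemma ccos_double (w : C) : ccos (2 * w) = (1 - 2 * (csin w * csin w))%C.
Proof.
  replace (1 - 2 * (csin w * csin w))%C
    with (ccos w * ccos w - csin w * csin w)%C by (rewrite <- (csin2_ccos2 w); ring).
  unfold csin, ccos. rewrite !Cexp_opp.
  replace (Ci * (2 * w))%C with (Ci * w + Ci * w)%C by ring. rewrite Cexp_add.
  set (x := Cexp (Ci * w)). assert (x <> 0) by apply Cexp_neq_0.
  transitivity ((x + / x) * (x + / x) / 4 - (x - / x) * (x - / x) / (4 * (Ci * Ci)))%C.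
  - rewrite Ci_sqr. field. repeat split; auto using C2_neq_0; intros E; injection E; lra.
  - field. repeat split; auto using Ci_neq_0, C2_neq_0; intros E; injection E; lra.
Qed.

Lemma csin_R (t : R) : csin (RtoC t) = RtoC (sin t).
Proof.
  unfold csin, Cexp. unfold Cdiv, Cinv, Cminus, Cplus, Copp, Cmult, Ci, RtoC, Re, Im; simpl.
  rewrite !Rmult_0_l, !Rmult_1_l, !Rmult_0_r, !Rminus_0_l, !Rplus_0_l, !Rplus_0_r, ?Ropp_0, !exp_0,
    !Rmult_1_l, cos_neg, sin_neg.
  f_equal; field.
Qed.

Lemma Cpartial_prod_S_l (a : nat -> C) n :
  Cpartial_prod a (S n) = (a O * Cpartial_prod (fun j => a (S j)) n)%C.
Proof. induction n; [simpl; ring|]. cbn [Cpartial_prod] in *. rewrite IHn. ring. Qed.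

(** Pairs each index with its mirror image and leaves the middle one alone; in the sine product this
    pairs the angles t and pi/2 - t. *)
Lemma Cpartial_prod_fold (a : nat -> C) m :
  Cpartial_prod a (2 * m + 1) = (a m * Cpartial_prod (fun j => a j * a (2 * m - j)%nat) m)%C.
Proof.
  revert a; induction m as [|m IH]; intros a; [simpl; ring|].
  replace (2 * S m + 1)%nat with (S (S (2 * m + 1))) by lia.
  rewrite (Cpartial_prod_S_l (fun j => a j * a (2 * S m - j)%nat)%C).
  rewrite (Cpartial_prod_S_l a). cbn [Cpartial_prod]. rewrite (IH (fun j => a (S j))).
  rewrite (Cpartial_prod_ext (fun j => a (S j) * a (2 * S m - S j)%nat)%C
    (fun j => a (S j) * a (S (2 * m - j)))%C) by (intros; f_equal; f_equal; lia).
  replace (2 * S m - 0)%nat with (S (2 * m + 1)) by lia. ring.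
Qed.

Definition sin_factor (p : nat) (x : C) (j : nat) : C :=
  (1 - csin x * csin x / (RtoC (sin (INR j * PI / 2 ^ p)) * RtoC (sin (INR j * PI / 2 ^ p))))%C.

Lemma pow2_pos (p : nat) : 0 < 2 ^ p.
Proof. apply pow_lt; lra. Qed.

Lemma RtoC_neq_0 (x : R) : x <> 0 -> RtoC x <> 0.
Proof. intros H E. injection E; auto. Qed.

Lemma INR_pow2 (p : nat) : INR (2 ^ p) = 2 ^ p.
Proof. rewrite pow_INR. simpl. f_equal; ring. Qed.

(** The finite form of Euler's product, for powers of two only, so that the duplication formulas are
    enough. In the induction, the factors at t and pi/2 - t merge into the factor at 2t for the
    doubled argument. *)
Lemma csin_pow2 (p : nat) (x : C) :
  csin (RtoC (2 ^ S p) * x) =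
  (RtoC (2 ^ S p) * csin x * ccos x *
    Cpartial_prod (fun j => sin_factor (S p) x (S j)) (2 ^ p - 1))%C.
Proof.
  revert x; induction p as [|p IH]; intros x.
  - simpl. rewrite Rmult_1_r, csin_double. ring.
  - replace (RtoC (2 ^ S (S p)) * x)%C with (RtoC (2 ^ S p) * (2 * x))%C
      by (change (2 ^ S (S p)) with (2 * 2 ^ S p); rewrite RtoC_mult; ring).
    rewrite IH, csin_double, ccos_double.
    assert (N1 : (1 <= 2 ^ p)%nat) by (apply Nat.neq_0_lt_0, Nat.pow_nonzero; lia).
    replace (2 ^ S p - 1)%nat with (2 * (2 ^ p - 1) + 1)%nat by (simpl; lia).
    rewrite Cpartial_prod_fold.
    (* The unpaired middle factor has angle pi/4, where sin^2 = 1/2; it is the cosine of the doubled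
       argument. *)
    replace (sin_factor (S (S p)) x (S (2 ^ p - 1))) with (1 - 2 * (csin x * csin x))%C.
    2: { unfold sin_factor. replace (S (2 ^ p - 1)) with (2 ^ p)%nat by lia.
         rewrite INR_pow2. replace (2 ^ p * PI / 2 ^ S (S p)) with (PI / 4)
           by (simpl; pose proof (pow2_pos p); field; lra).
         rewrite sin_PI4, <- RtoC_mult.
         replace (1 / sqrt 2 * (1 / sqrt 2)) with (/ 2).
         - rewrite RtoC_inv by lra. field.
         - assert (0 < sqrt 2) by (apply sqrt_lt_R0; lra).
           pose proof (sqrt_sqrt 2 ltac:(lra)) as E.
           apply Rmult_eq_reg_r with (sqrt 2 * sqrt 2); [|nra]. field_simplify; [|lra].
           simpl; lra. }
    rewrite (Cpartial_prod_ext (fun j => sin_factor (S (S p)) x (S j) *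
       sin_factor (S (S p)) x (S (2 * (2 ^ p - 1) - j)))%C
       (fun j => sin_factor (S p) (2 * x) (S j))).
    { change (2 ^ S (S p)) with (2 * 2 ^ S p). rewrite RtoC_mult. ring. }
    intros j Hj. unfold sin_factor.
    rewrite csin_double.
    set (t := INR (S j) * PI / 2 ^ S (S p)).
    replace (INR (S (2 * (2 ^ p - 1) - j)) * PI / 2 ^ S (S p)) with (PI / 2 - t).
    2: { unfold t. replace (S (2 * (2 ^ p - 1) - j)) with (2 * 2 ^ p - S j)%nat by lia.
         rewrite minus_INR by lia. rewrite mult_INR, INR_pow2. simpl (INR 2).
         simpl (2 ^ S (S p)). pose proof (pow2_pos p). field. lra. }
    replace (INR (S j) * PI / 2 ^ S p) with (2 * t).
    2: { unfold t. simpl (2 ^ S (S p)). simpl (2 ^ S p). pose proof (pow2_pos p). field. lra. }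
    rewrite sin_shift, sin_2a.
    assert (Ht : 0 < t < PI / 2).
    { unfold t. pose proof PI_RGT_0. pose proof (pow2_pos p).
      assert (J : 0 < INR (S j)) by (apply lt_0_INR; lia).
      assert (J2 : INR (S j) < 2 ^ p) by (rewrite <- INR_pow2; apply lt_INR; lia).
      simpl (2 ^ S (S p)). split.
      - apply Rdiv_lt_0_compat; [|lra]. now apply Rmult_lt_0_compat.
      - apply Rmult_lt_reg_r with (2 * (2 * 2 ^ p)); [lra|].
        replace (INR (S j) * PI / (2 * (2 * 2 ^ p)) * (2 * (2 * 2 ^ p))) with (INR (S j) * PI)
          by (field; lra). nra. }
    assert (Hs : RtoC (sin t) <> 0) by (apply RtoC_neq_0, Rgt_not_eq, sin_gt_0; lra).
    assert (Hc : RtoC (cos t) <> 0) by (apply RtoC_neq_0, Rgt_not_eq, cos_gt_0; lra).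
    assert (E1 : (RtoC (cos t) * RtoC (cos t) = 1 - RtoC (sin t) * RtoC (sin t))%C).
    { rewrite <- !RtoC_mult, <- RtoC_minus. f_equal.
      pose proof (sin2_cos2 t) as E; unfold Rsqr in E; lra. }
    rewrite !RtoC_mult.
    pose proof (csin2_ccos2 x) as E2.
    assert (E3 : (ccos x * ccos x = 1 - csin x * csin x)%C) by (rewrite <- E2; ring).
    (* Writing s for the sine of x, the product of the two paired factors is 1 - s^2 (1 - s^2) /
       (sin^2 t cos^2 t), and 1 - s^2 is the squared cosine that duplication of the sine asks
       for. *)
    transitivity (1 - csin x * csin x * (RtoC (cos t) * RtoC (cos t) + RtoC (sin t) * RtoC (sin t)
        - csin x * csin x) / (RtoC (cos t) * RtoC (cos t) * (RtoC (sin t) * RtoC (sin t))))%C.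
    + field; auto.
    + replace (RtoC (cos t) * RtoC (cos t) + RtoC (sin t) * RtoC (sin t) - csin x * csin x)%C
        with (ccos x * ccos x)%C by (rewrite E1, E3; ring).
      field. repeat split; auto using C2_neq_0.
Qed.

Lemma is_lim_seq_half_pow : is_lim_seq (fun p => (1/2) ^ p) 0.
Proof. apply is_lim_seq_geom, Rabs_lt_between; lra. Qed.

Lemma derive_lim_seq (f : R -> R) (l : R) :
  is_derive f 0 l -> is_lim_seq (fun p => 2 ^ p * (f ((1/2) ^ p) - f 0)) l.
Proof.
  intros H. apply is_derive_Reals in H. apply is_lim_seq_spec. intros eps.
  destruct (H eps (cond_pos eps)) as [d Hd].
  destruct (proj2 (is_lim_seq_spec _ _) is_lim_seq_half_pow d) as [N HN].
  exists N; intros p Hp. specialize (HN p Hp). rewrite Rminus_0_r in HN.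
  assert (P : 0 < (1/2) ^ p) by (apply pow_lt; lra).
  specialize (Hd ((1/2)^p) ltac:(lra) HN). rewrite Rplus_0_l in Hd.
  assert (E : 2 ^ p = / (1/2) ^ p).
  { rewrite <- pow_inv. f_equal; field. }
  rewrite E. replace (/ (1 / 2) ^ p * (f ((1 / 2) ^ p) - f 0))
    with ((f ((1 / 2) ^ p) - f 0) / (1 / 2) ^ p) by (field; lra). exact Hd.
Qed.

Lemma Cexp_derive_lim (z : C) :
  Clim (fun p => RtoC (2 ^ p) * (Cexp (RtoC ((1/2) ^ p) * z) - 1))%C z.
Proof.
  destruct z as [a b].
  assert (E : forall h, Cexp (RtoC h * (a, b)) = (exp (h * a) * cos (h * b), exp (h * a) * sin (h * b))).
  { intros h. unfold Cexp, RtoC, Cmult, Re, Im; simpl.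
    replace (h * a - 0 * b) with (h * a) by ring. now replace (h * b + 0 * a) with (h * b) by ring. }
  apply Clim_of_parts.
  - apply is_lim_seq_ext with (fun p => 2 ^ p *
      (exp ((1/2) ^ p * a) * cos ((1/2) ^ p * b) - exp (0 * a) * cos (0 * b))).
    + intros p. rewrite E, !Rmult_0_l, exp_0, cos_0.
      generalize ((1/2) ^ p), (2 ^ p). intros. unfold RtoC, Cminus, Cplus, Copp, Cmult, Re; simpl. ring.
    + apply (derive_lim_seq (fun h => exp (h * a) * cos (h * b))).
      auto_derive; auto. rewrite !Rmult_0_l, exp_0, cos_0, sin_0. ring.
  - apply is_lim_seq_ext with (fun p => 2 ^ p *
      (exp ((1/2) ^ p * a) * sin ((1/2) ^ p * b) - exp (0 * a) * sin (0 * b))).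
    + intros p. rewrite E, !Rmult_0_l, exp_0, sin_0.
      generalize ((1/2) ^ p), (2 ^ p). intros. unfold RtoC, Cminus, Cplus, Copp, Cmult, Im; simpl. ring.
    + apply (derive_lim_seq (fun h => exp (h * a) * sin (h * b))).
      auto_derive; auto. rewrite !Rmult_0_l, exp_0, cos_0, sin_0. ring.
Qed.

Lemma Clim_half_pow : Clim (fun p => RtoC ((1/2) ^ p)) 0.
Proof.
  apply Clim_squeeze with (fun p => (1/2) ^ p); [apply is_lim_seq_half_pow|].
  exists O; intros p _. rewrite <- RtoC_minus, Cmod_R, Rminus_0_r, Rabs_pos_eq; [lra|].
  apply pow_le; lra.
Qed.

Lemma Cexp_lim_1 (z : C) : Clim (fun p => Cexp (RtoC ((1/2) ^ p) * z))%C 1.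
Proof.
  pose proof (Clim_mult _ _ _ _ Clim_half_pow (Cexp_derive_lim z)) as L.
  apply (Clim_plus _ _ _ _ (Clim_const 1)) in L.
  replace (1 + 0 * z)%C with (RtoC 1) in L by ring. revert L; apply Clim_ext; intros p.
  rewrite Cmult_assoc, <- RtoC_mult, <- Rpow_mult_distr.
  replace (1 / 2 * 2) with 1 by field. rewrite pow1. ring.
Qed.

Lemma csin_lim (w : C) : Clim (fun p => RtoC (2 ^ p) * csin (RtoC ((1/2) ^ p) * w))%C w.
Proof.
  pose proof (Clim_minus _ _ _ _ (Cexp_derive_lim (Ci * w)) (Cexp_derive_lim (- (Ci * w)))) as L.
  apply (Clim_scal (/ (2 * Ci))) in L.
  replace (/ (2 * Ci) * (Ci * w - - (Ci * w)))%C with w in L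
    by (field; auto using Ci_neq_0).
  revert L; apply Clim_ext; intros p. unfold csin.
  replace (Ci * (RtoC ((1/2) ^ p) * w))%C with (RtoC ((1/2) ^ p) * (Ci * w))%C by ring.
  replace (- (RtoC ((1/2) ^ p) * (Ci * w)))%C with (RtoC ((1/2) ^ p) * - (Ci * w))%C by ring.
  field; auto using Ci_neq_0.
Qed.

Lemma ccos_lim (w : C) : Clim (fun p => ccos (RtoC ((1/2) ^ p) * w))%C 1.
Proof.
  pose proof (Clim_plus _ _ _ _ (Cexp_lim_1 (Ci * w)) (Cexp_lim_1 (- (Ci * w)))) as L.
  apply (Clim_scal (/ 2)) in L.
  replace (/ 2 * (1 + 1))%C with (RtoC 1) in L by (field).
  revert L; apply Clim_ext; intros p. unfold ccos.
  replace (Ci * (RtoC ((1/2) ^ p) * w))%C with (RtoC ((1/2) ^ p) * (Ci * w))%C by ring.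
  replace (- (RtoC ((1/2) ^ p) * (Ci * w)))%C with (RtoC ((1/2) ^ p) * - (Ci * w))%C by ring.
  field.
Qed.

(** Comparison with a telescoping series. It is used for the exponents 2 and 3/2, with [d] a
    multiple of 1/j and of 1/sqrt j. *)
Lemma Rpartial_sum_cv_bound (b d : nat -> R) :
  (forall n, 0 <= b n) -> (forall n, 0 <= d n) -> (forall n, b n <= d n - d (S n)) ->
  exists B : R, is_lim_seq (Rpartial_sum b) B.
Proof.
  intros Hb Hd H. apply ex_finite_lim_seq_incr with (d O).
  - intros n; simpl. pose proof (Hb n); lra.
  - intros n. assert (E : Rpartial_sum b n <= d O - d n).
    { induction n; simpl; [lra|]. pose proof (H n); lra. }
    pose proof (Hd n); lra.
Qed.

Lemma sum_inv_sqr_cv (c : R) : 0 <= c ->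
  exists B : R, is_lim_seq (Rpartial_sum (fun j => c / (INR (S j) * INR (S j)))) B.
Proof.
  intros Hc. assert (P : forall n, 0 < INR (S n)) by (intros; apply lt_0_INR; lia).
  apply Rpartial_sum_cv_bound with (fun n => 2 * c / INR (S n)); intros n; specialize (P n).
  - apply Rdiv_le_0_compat; nra.
  - apply Rdiv_le_0_compat; lra.
  - rewrite (S_INR (S n)). set (x := INR (S n)) in *.
    assert (1 <= x) by (unfold x; rewrite S_INR; pose proof (pos_INR n); lra).
    apply Rmult_le_reg_r with (x * x * (x + 1)); [apply Rmult_lt_0_compat; nra|].
    field_simplify; [|lra|lra]. nra.
Qed.

(** From sin t >= t - t^3/6, where t^2 <= 4. *)
Lemma sin_ge_third (t : R) : 0 <= t <= 2 -> t / 3 <= sin t.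
Proof.
  intros Ht. destruct (pre_sin_bound t 0 ltac:(lra) ltac:(lra)) as [H _].
  unfold sin_approx, sin_term in H. simpl in H. nra.
Qed.

Lemma sine_product (y : C) :
  Clim (fun N => y * Cpartial_prod (fun j => 1 - y * y / RtoC (INR (S j) * INR (S j))) N)%C
    (csin (RtoC PI * y) / RtoC PI)%C.
Proof.
  assert (HPI : RtoC PI <> 0) by (apply RtoC_neq_0, PI_neq0).
  set (w := (RtoC PI * y)%C).
  (* Numerators and denominators of the finite product are both rescaled by 2^(p+1), so that they
     have the finite limits [w] and (j+1) pi. *)
  set (sg := fun p => (RtoC (2 ^ S p) * csin (RtoC ((1/2) ^ S p) * w))%C).
  assert (SP : filterlim S eventually eventually)
    by (apply filterlim_eventually_intro; intros N; exists N; intros; lia).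
  assert (Hsg : Clim sg w) by exact (Clim_subseq _ _ S SP (csin_lim w)).
  destruct (Clim_bounded _ _ Hsg) as [K [HK HKb]].
  set (den := fun p j => RtoC (2 ^ S p * sin (INR (S j) * PI / 2 ^ S p))).
  assert (Hden : forall j, Clim (fun p => den p j) (RtoC (INR (S j) * PI))).
  { intros j. pose proof (Clim_subseq _ _ S SP (csin_lim (RtoC (INR (S j) * PI)))) as L.
    revert L; apply Clim_ext; intros p. unfold den.
    rewrite <- RtoC_mult, csin_R, <- RtoC_mult. do 3 f_equal.
    replace ((1/2) ^ S p) with (/ 2 ^ S p) by (rewrite <- pow_inv; f_equal; field).
    unfold Rdiv; ring. }
  assert (Hj : forall j, 1 <= INR (S j)) by (intros; rewrite S_INR; pose proof (pos_INR j); lra).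
  (* The index range keeps the angle below pi/2 <= 2, so [sin_ge_third] applies; it yields (j+1)
     pi/3, and pi > 2 leaves room for the factor 1/2. *)
  assert (Dlow : forall p j, (j < 2 ^ p - 1)%nat -> INR (S j) / 2 <= Cmod (den p j)).
  { intros p j H. unfold den. rewrite Cmod_R. eapply Rle_trans; [|apply Rle_abs].
    pose proof PI_4. pose proof PI2_1.
    assert (J2 : INR (S j) < 2 ^ p) by (rewrite <- INR_pow2; apply lt_INR; lia).
    specialize (Hj j). pose proof (pow2_pos p).
    set (t := INR (S j) * PI / 2 ^ S p).
    assert (Et : t * 2 ^ S p = INR (S j) * PI) by (unfold t; field; pose proof (pow2_pos (S p)); lra).
    simpl (2 ^ S p) in *.
    assert (0 <= t) by (unfold t; apply Rdiv_le_0_compat; nra).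
    assert (t <= 2) by nra.
    pose proof (sin_ge_third t ltac:(lra)). nra. }
  (* Padding by 1 past the last factor makes the finite products infinite, so that one majorant [b]
     serves all p. *)
  set (a := fun p j => if Nat.ltb j (2 ^ p - 1)
     then (1 - sg p * sg p / (den p j * den p j))%C else RtoC 1).
  set (b := fun j => (4 * (K * K)) / (INR (S j) * INR (S j))).
  assert (Hb0 : forall j, 0 <= b j).
  { intros j. unfold b. specialize (Hj j). apply Rdiv_le_0_compat; nra. }
  destruct (sum_inv_sqr_cv (4 * (K * K)) ltac:(nra)) as [B HB]. fold b in HB.
  assert (Ha : forall p j, Cmod (a p j - 1) <= b j).
  { intros p j. unfold a. destruct (Nat.ltb_spec j (2 ^ p - 1)) as [H|H].
    - specialize (Dlow p j H). specialize (Hj j).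
      assert (D0 : den p j <> 0) by (apply Cmod_gt_0; lra).
      replace (1 - sg p * sg p / (den p j * den p j) - 1)%C
        with (- (sg p * sg p / (den p j * den p j)))%C by ring.
      rewrite Cmod_opp, Cmod_div, !Cmod_mult by (apply Cmult_neq_0; auto).
      unfold b. replace (4 * (K * K) / (INR (S j) * INR (S j)))
        with ((K * K) * / (INR (S j) / 2 * (INR (S j) / 2))) by (field; lra).
      unfold Rdiv at 1. pose proof (HKb p). pose proof (Cmod_ge_0 (sg p)).
      apply Rmult_le_compat; [nra | | nra |].
      + left; apply Rinv_0_lt_compat. nra.
      + apply Rinv_le_contravar; nra.
    - replace (1 - 1)%C with (RtoC 0) by ring. rewrite Cmod_0. apply Hb0. }
  set (a' := fun j => (1 - y * y / RtoC (INR (S j) * INR (S j)))%C).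
  assert (Haa : forall j, Clim (fun p => a p j) (a' j)).
  { intros j. specialize (Hj j).
    apply Clim_ext_loc with (fun p => 1 - sg p * sg p / (den p j * den p j))%C.
    - exists (S j). intros p Hp. unfold a.
      assert (p < 2 ^ p)%nat by (apply Nat.pow_gt_lin_r; lia).
      destruct (Nat.ltb_spec j (2 ^ p - 1)); auto; lia.
    - replace (a' j) with (1 - w * w / (RtoC (INR (S j) * PI) * RtoC (INR (S j) * PI)))%C.
      + assert (RtoC (INR (S j) * PI) <> 0).
        { apply RtoC_neq_0. pose proof PI_RGT_0. nra. }
        apply Clim_minus; [apply Clim_const|].
        apply Clim_div; auto using Cmult_neq_0, Clim_mult.
      + unfold a', w. rewrite !RtoC_mult. field. split; auto. apply RtoC_neq_0; lra. }
  assert (Ha' : forall j, Cmod (a' j - 1) <= b j).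
  { intros j. apply (Clim_le (fun p => a p j - 1)%C); [exists O; auto|].
    apply Clim_minus; auto using Clim_const. }
  destruct (Cpartial_prod_cv a' b B Ha' Hb0 HB) as [l Hl].
  assert (HU : Clim (fun p => Cpartial_prod (a p) (2 ^ p - 1)) l).
  { apply (Clim_exchange (fun p n => Cpartial_prod (a p) n) _ (Cpartial_prod a') l
      (fun m => exp B - exp (Rpartial_sum b m))); auto.
    - intros p. eapply Clim_ext_loc; [|apply Clim_const].
      exists (2 ^ p - 1)%nat. intros n Hn.
      induction Hn as [|n Hn IH]; auto. cbn [Cpartial_prod]. rewrite <- IH.
      unfold a at 3. destruct (Nat.ltb_spec n (2 ^ p - 1)); [lia | ring].
    - intros n. now apply Clim_partial_prod.
    - now apply is_lim_seq_exp_diff.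
    - intros p m n Hmn. now apply Cpartial_prod_dist_exp. }
  assert (E : csin w = (w * 1 * l)%C).
  { apply (Clim_unique (fun p => sg p * ccos (RtoC ((1/2) ^ S p) * w)
       * Cpartial_prod (a p) (2 ^ p - 1))%C).
    - apply Clim_ext with (fun _ : nat => csin w); [|apply Clim_const]. intros p.
      replace w with (RtoC (2 ^ S p) * (RtoC ((1/2) ^ S p) * w))%C at 1.
      2: { rewrite Cmult_assoc, <- RtoC_mult, <- Rpow_mult_distr.
           replace (2 * (1 / 2)) with 1 by field. rewrite pow1. ring. }
      rewrite csin_pow2. unfold sg. f_equal.
      apply Cpartial_prod_ext. intros j H. unfold a, sin_factor.
      rewrite (proj2 (Nat.ltb_lt _ _) H).
      specialize (Dlow p j H). specialize (Hj j).
      assert (D0 : den p j <> 0) by (apply Cmod_gt_0; lra).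
      unfold sg, den in *. rewrite RtoC_mult in D0. rewrite RtoC_mult.
      assert (D1 : RtoC (sin (INR (S j) * PI / 2 ^ S p)) <> 0).
      { intros E; apply D0; rewrite E; ring. }
      assert (D2 : RtoC (2 ^ S p) <> 0).
      { intros E; apply D0; rewrite E; ring. }
      field; auto.
    - apply Clim_mult; auto. apply Clim_mult; auto.
      exact (Clim_subseq _ _ S SP (ccos_lim w)). }
  rewrite E. replace (w * 1 * l / RtoC PI)%C with (y * l)%C by (unfold w; field; auto).
  now apply Clim_scal.
Qed.

(** * Modular transformation of a theta quotient *)

Lemma qnome_add (s t : C) : qnome (s + t) = (qnome s * qnome t)%C.
Proof. unfold qnome. rewrite <- Cexp_add. f_equal; ring. Qed.

Lemma qnome_0 : qnome 0 = 1.
Proof. unfold qnome. rewrite <- Cexp_0. f_equal; ring. Qed.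

Lemma qnome_neq_0 (t : C) : qnome t <> 0.
Proof. apply Cexp_neq_0. Qed.

Lemma Cmod_qnome (t : C) : Cmod (qnome t) = exp (- (2 * PI * Im t)).
Proof.
  unfold qnome. rewrite Cmod_Cexp. f_equal. destruct t as [a b].
  unfold RtoC, Ci, Cmult, Re, Im; simpl. ring.
Qed.

Lemma Cmod_qnome_lt_1 (t : C) : 0 < Im t -> 0 < Cmod (qnome t) < 1.
Proof.
  intros H. rewrite Cmod_qnome. split; [apply exp_pos|].
  rewrite <- exp_0. apply exp_increasing. pose proof PI_RGT_0. nra.
Qed.

Lemma qnome_Zmult (n : Z) (t : C) : qnome (RtoC (IZR n) * t) = zpow (qnome t) n.
Proof.
  pose proof (qnome_neq_0 t). revert n. apply Z_ind_step.
  - rewrite zpow_0. replace (RtoC (IZR 0) * t)%C with (RtoC 0) by ring. apply qnome_0.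
  - intros n. rewrite zpow_succ, plus_IZR, RtoC_plus by auto.
    replace ((RtoC (IZR n) + RtoC (IZR 1)) * t)%C with (RtoC (IZR n) * t + t)%C by ring.
    rewrite qnome_add. split; intros E; [now rewrite E | now apply (Cmult_cancel_r _ _ (qnome t))].
Qed.

Lemma qnome_Z (n : Z) : qnome (RtoC (IZR n)) = 1.
Proof.
  replace (RtoC (IZR n)) with (RtoC (IZR n) * 1)%C by ring. rewrite qnome_Zmult.
  replace (qnome 1) with (RtoC 1); [apply zpow_1_l|].
  unfold qnome, Cexp. unfold RtoC, Ci, Cmult, Re, Im; simpl.
  replace (2 * PI * (0 * 1 - 1 * 0) - 0 * (0 * 0 + 1 * 1)) with 0 by ring.
  replace (2 * PI * (0 * 0 + 1 * 1) + 0 * (0 * 1 - 1 * 0)) with (2 * PI) by ring.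
  rewrite exp_0, cos_2PI, sin_2PI. f_equal; ring.
Qed.

(** * Rows of the lattice: from linear factors to nomes *)

Definition sine_norm (N : nat) : C :=
  Cpartial_prod (fun j => - RtoC (INR (S j) * INR (S j)))%C N.

Lemma RtoC_INR_S_neq_0 (j : nat) : RtoC (INR (S j) * INR (S j)) <> 0.
Proof.
  apply RtoC_neq_0. pose proof (lt_0_INR (S j) ltac:(lia)). nra.
Qed.

(** Each pair (y + n)(y - n) is -n^2 times an Euler factor; [sine_norm] collects the divergent -n^2.
    The sine is written as a half-exponential times 1 - e(y), since in a quotient of equal degree
    and equal sums of arguments the constants and half-exponentials cancel. *)
Lemma sine_zprod (y : C) :
  Clim (fun N => zprod (fun n => y + RtoC (IZR n)) N / sine_norm N)%C
    (/ (- (2 * Ci * RtoC PI)) * (Cexp (- (Ci * RtoC PI * y)) * (1 - qnome y)))%C.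
Proof.
  assert (HPI : RtoC PI <> 0) by (apply RtoC_neq_0, PI_neq0).
  pose proof (sine_product y) as L.
  replace (/ (- (2 * Ci * RtoC PI)) * (Cexp (- (Ci * RtoC PI * y)) * (1 - qnome y)))%C
    with (csin (RtoC PI * y) / RtoC PI)%C.
  - revert L; apply Clim_ext; intros N.
    assert (E : zprod (fun n => y + RtoC (IZR n))%C N = (sine_norm N *
      (y * Cpartial_prod (fun j => 1 - y * y / RtoC (INR (S j) * INR (S j))) N))%C).
    { unfold sine_norm. induction N as [|N IH].
      - rewrite zprod_0. simpl. ring.
      - rewrite zprod_S, IH. cbn [Cpartial_prod]. unfold zpos, zneg.
        rewrite opp_IZR, <- INR_IZR_INZ, RtoC_opp, !RtoC_mult.
        assert (RtoC (INR (S N)) <> 0) by (apply RtoC_neq_0, not_0_INR; lia).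
        field; auto. }
    rewrite E. field. apply Cpartial_prod_neq_0; intros. apply Copp_neq_0, RtoC_INR_S_neq_0.
  - unfold csin, qnome.
    replace (RtoC (2 * PI) * (Ci * y))%C with (Ci * (RtoC PI * y) + Ci * (RtoC PI * y))%C
      by (rewrite RtoC_mult; ring).
    replace (Ci * RtoC PI * y)%C with (Ci * (RtoC PI * y))%C by ring.
    rewrite Cexp_add, Cexp_opp. pose proof (Cexp_neq_0 (Ci * (RtoC PI * y))).
    field. repeat split; auto using Ci_neq_0, C2_neq_0.
Qed.

(* The multiples of [z] are chosen so that their sums and their sums of squares in numerator and
   denominator agree; hence [lattice_factor z l] is [1 + O(l^-3)]. *)
Definition lattice_factor (z l : C) : C :=
  ((l + 3 * z) * (l - 5 * z) * (l - 2 * z) / ((l - 6 * z) * (l + z) ^ 2))%C.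

Definition nome_factor (x p : C) : C :=
  ((1 - p * x ^ 3) * (1 - p / x ^ 5) * (1 - p / x ^ 2) / ((1 - p / x ^ 6) * (1 - p * x) ^ 2))%C.

(** Equal sums and sums of squares make the coefficients of l^2 and l agree; only the products of
    the multiples differ, by 30 - (-6) = 36. *)
Lemma lattice_factor_minus_1 (z l : C) : (l - 6 * z)%C <> 0 -> (l + z)%C <> 0 ->
  (lattice_factor z l - 1)%C = (36 * z ^ 3 / ((l - 6 * z) * (l + z) ^ 2))%C.
Proof. intros. unfold lattice_factor. field; auto. Qed.

Lemma qnome_eq_1_shift (y : C) (n : Z) : (1 - qnome y)%C <> 0 -> (y + RtoC (IZR n))%C <> 0.
Proof.
  intros H E. apply H. replace y with (- RtoC (IZR n))%C.
  - rewrite <- RtoC_opp, <- opp_IZR, qnome_Z. ring.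
  - replace (- RtoC (IZR n))%C with (y - (y + RtoC (IZR n)))%C by ring. rewrite E; ring.
Qed.

(** Three sine products over three: the normalisation cancels by degree, and what survives are the
    factors 1 - e(w + k z) = 1 - p x^k. *)
Lemma lattice_row (z w : C) :
  (1 - qnome w / qnome z ^ 6)%C <> 0 -> (1 - qnome w * qnome z)%C <> 0 ->
  Clim (zprod (fun n => lattice_factor z (w + RtoC (IZR n)))) (nome_factor (qnome z) (qnome w)).
Proof.
  intros H6 H1.
  assert (Hx : qnome z <> 0) by apply qnome_neq_0.
  assert (Q : forall k : Z, qnome (w + RtoC (IZR k) * z) = (qnome w * zpow (qnome z) k)%C).
  { intros k. now rewrite qnome_add, qnome_Zmult. }
  assert (Q6 : qnome (w + RtoC (IZR (-6)) * z) = (qnome w / qnome z ^ 6)%C) by apply Q.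
  assert (Q5 : qnome (w + RtoC (IZR (-5)) * z) = (qnome w / qnome z ^ 5)%C) by apply Q.
  assert (Q2 : qnome (w + RtoC (IZR (-2)) * z) = (qnome w / qnome z ^ 2)%C) by apply Q.
  assert (Q1 : qnome (w + RtoC (IZR 1) * z) = (qnome w * qnome z)%C).
  { rewrite Q. now rewrite zpow_1. }
  assert (Q3 : qnome (w + RtoC (IZR 3) * z) = (qnome w * qnome z ^ 3)%C) by apply Q.
  set (y6 := (w + RtoC (IZR (-6)) * z)%C) in *. set (y5 := (w + RtoC (IZR (-5)) * z)%C) in *.
  set (y2 := (w + RtoC (IZR (-2)) * z)%C) in *. set (y1 := (w + RtoC (IZR 1) * z)%C) in *.
  set (y3 := (w + RtoC (IZR 3) * z)%C) in *.
  assert (N6 : forall n, (y6 + RtoC (IZR n))%C <> 0)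
    by (intros; apply qnome_eq_1_shift; now rewrite Q6).
  assert (N1 : forall n, (y1 + RtoC (IZR n))%C <> 0)
    by (intros; apply qnome_eq_1_shift; now rewrite Q1).
  assert (HPI : RtoC PI <> 0) by (apply RtoC_neq_0, PI_neq0).
  set (k0 := (/ (- (2 * Ci * RtoC PI)))%C).
  assert (Hk0 : k0 <> 0).
  { apply Cinv_nz, Copp_neq_0, Cmult_neq_0; auto. apply Cmult_neq_0; auto using Ci_neq_0, C2_neq_0. }
  pose proof (sine_zprod y3) as L3. pose proof (sine_zprod y5) as L5.
  pose proof (sine_zprod y2) as L2. pose proof (sine_zprod y6) as L6.
  pose proof (sine_zprod y1) as L1. fold k0 in L1, L2, L3, L5, L6.
  rewrite Q3 in L3. rewrite Q5 in L5. rewrite Q2 in L2. rewrite Q6 in L6. rewrite Q1 in L1.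
  set (e := fun y => Cexp (- (Ci * RtoC PI * y))).
  fold (e y1) in L1. fold (e y2) in L2. fold (e y3) in L3. fold (e y5) in L5. fold (e y6) in L6.
  assert (e0 : forall y, e y <> 0) by (intros; apply Cexp_neq_0).
  (* The exponents agree because 3 - 5 - 2 = -6 + 1 + 1. *)
  assert (Ee : (e y3 * e y5 * e y2 = e y6 * e y1 ^ 2)%C).
  { unfold e. simpl. rewrite Cmult_1_r, <- !Cexp_add. f_equal.
    unfold y1, y2, y3, y5, y6. ring. }
  assert (LL := Clim_div _ _ _ _
    (Cmult_neq_0 _ _ (Cmult_neq_0 _ _ Hk0 (Cmult_neq_0 _ _ (e0 y6) H6))
       (Cpow_nz _ 2 (Cmult_neq_0 _ _ Hk0 (Cmult_neq_0 _ _ (e0 y1) H1))))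
    (Clim_mult _ _ _ _ (Clim_mult _ _ _ _ L3 L5) L2)
    (Clim_mult _ _ _ _ L6 (Clim_pow _ _ 2 L1))).
  cbv beta in LL.
  match type of LL with Clim _ ?l => replace (nome_factor (qnome z) (qnome w)) with l end.
  - revert LL; apply Clim_ext; intros N.
    set (s := sine_norm N). assert (Hs : s <> 0).
    { apply Cpartial_prod_neq_0; intros. apply Copp_neq_0, RtoC_INR_S_neq_0. }
    transitivity ((zprod (fun n => y3 + RtoC (IZR n)) N * zprod (fun n => y5 + RtoC (IZR n)) N *
       zprod (fun n => y2 + RtoC (IZR n)) N) / (zprod (fun n => y6 + RtoC (IZR n)) N *
       zprod (fun n => y1 + RtoC (IZR n)) N ^ 2))%C.
    + pose proof (zprod_neq_0 _ N N6). pose proof (zprod_neq_0 _ N N1). field; auto.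
    + rewrite <- !zprod_mult, <- zprod_pow, <- zprod_mult, <- zprod_div.
      * apply zprod_ext; intros n. unfold lattice_factor, y1, y2, y3, y5, y6.
        f_equal; [ring | f_equal; ring].
      * intros n. apply Cmult_neq_0; auto. apply Cpow_nz; auto.
  - unfold nome_factor.
    transitivity ((e y3 * e y5 * e y2) / (e y6 * e y1 ^ 2) * ((1 - qnome w * qnome z ^ 3) *
      (1 - qnome w / qnome z ^ 5) * (1 - qnome w / qnome z ^ 2) /
      ((1 - qnome w / qnome z ^ 6) * (1 - qnome w * qnome z) ^ 2)))%C.
    + generalize (1 - qnome w * qnome z ^ 3)%C, (1 - qnome w / qnome z ^ 5)%C,
        (1 - qnome w / qnome z ^ 2)%C.
      revert H6 H1. generalize (1 - qnome w / qnome z ^ 6)%C, (1 - qnome w * qnome z)%C.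
      generalize (e0 y1), (e0 y6). intros. field; auto.
    + rewrite Ee. assert ((e y6 * e y1 ^ 2)%C <> 0) by (apply Cmult_neq_0; auto; now apply Cpow_nz).
      set (r := (_ / (_ * (1 - qnome w * qnome z) ^ 2))%C).
      replace (e y6 * e y1 ^ 2 / (e y6 * e y1 ^ 2) * r)%C with r by (field; auto). reflexivity.
Qed.

(** Degree 0 allows division by w, which turns a column of Z w + Z into a row of the lattice spanned
    by 1 and -1/w. *)
Lemma lattice_factor_homogeneous (z l w : C) : w <> 0 ->
  (l - 6 * z)%C <> 0 -> (l + z)%C <> 0 ->
  lattice_factor (z / w) (l / w) = lattice_factor z l.
Proof.
  intros Hw H6 H1. unfold lattice_factor.
  assert (E6 : (l / w - 6 * (z / w))%C = ((l - 6 * z) / w)%C) by (field; auto).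
  assert (E1 : (l / w + z / w)%C = ((l + z) / w)%C) by (field; auto).
  rewrite E6, E1. field; auto.
Qed.

Definition theta_quotient (q x : C) : C :=
  (theta q (x ^ 3) * theta q (/ x ^ 5) * theta q (/ x ^ 2) / (theta q (/ x ^ 6) * theta q x ^ 2))%C.

(** Negative powers are turned round by 1 - a/q^k = -(a/q^k)(1 - q^k/a). A symmetric window has one
    factor more than the N theta factors cover, namely 1 - a q^N, which tends to 1; the last product
    diverges and must cancel in a quotient. *)
Lemma zprod_theta (q a : C) N : q <> 0 -> a <> 0 ->
  zprod (fun m => 1 - a * zpow q m)%C N =
  (Cpartial_prod (theta_factor q a) N * (1 - a * q ^ N) *
     Cpartial_prod (fun j => - (a / q ^ S j)) N)%C.
Proof.
  intros Hq Ha. induction N as [|N IH].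
  - rewrite zprod_0, zpow_0. simpl. ring.
  - rewrite zprod_S, IH. unfold zpos, zneg. rewrite zpow_of_nat, zpow_opp_nat by auto.
    cbn [Cpartial_prod]. unfold theta_factor. cbn [Cpow]. pose proof (Cpow_nz q N Hq).
    field; auto.
Qed.

Lemma Clim_pow_0 (q : C) : Cmod q < 1 -> Clim (fun n => q ^ n)%C 0.
Proof.
  intros Hq. apply Clim_squeeze with (fun n => Cmod q ^ n).
  - apply is_lim_seq_geom. rewrite Rabs_pos_eq; auto using Cmod_ge_0.
  - exists O; intros n _. replace (q ^ n - 0)%C with (q ^ n)%C by ring. rewrite Cmod_pow; lra.
Qed.

Lemma nome_product (q x : C) : 0 < Cmod q < 1 -> x <> 0 ->
  (forall m, (/ x ^ 6 * zpow q m)%C <> 1) -> (forall m, (x * zpow q m)%C <> 1) ->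
  Clim (zprod (fun m => nome_factor x (zpow q m))) (theta_quotient q x).
Proof.
  intros Hq Hx H6 H1. assert (Hq0 : q <> 0) by (apply Cmod_gt_0; lra).
  destruct (qfac_cv q ltac:(lra)) as [l [Hl Hl0]].
  assert (Hi : forall k, (/ x ^ k)%C <> 0) by (intros; now apply Cinv_nz, Cpow_nz).
  assert (L : forall a : C, a <> 0 -> Clim (fun N => Cpartial_prod (theta_factor q a) N * (1 - a * q ^ N))%C
     (theta q a / l)%C).
  { intros a Ha. replace (theta q a / l)%C with (theta q a / l * (1 - a * 0))%C by ring.
    apply Clim_mult; [now apply theta_product|].
    apply Clim_minus; [apply Clim_const|]. apply Clim_scal, Clim_pow_0; lra. }
  pose proof (theta_neq_0 q _ Hq (Hi 6%nat) H6) as T6. pose proof (theta_neq_0 q x Hq Hx H1) as T1.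
  assert (LL := Clim_div _ _ _ _
    (Cmult_neq_0 _ _ (Cdiv_nz _ _ T6 Hl0) (Cpow_nz _ 2 (Cdiv_nz _ _ T1 Hl0)))
    (Clim_mult _ _ _ _ (Clim_mult _ _ _ _ (L _ (Cpow_nz x 3 Hx)) (L _ (Hi 5%nat))) (L _ (Hi 2%nat)))
    (Clim_mult _ _ _ _ (L _ (Hi 6%nat)) (Clim_pow _ _ 2 (L _ Hx)))).
  cbv beta in LL.
  match type of LL with Clim _ ?l => replace (theta_quotient q x) with l end.
  2: { unfold theta_quotient. field; auto. }
  revert LL; apply Clim_ext; intros N.
  assert (G6 : forall m, (1 - / x ^ 6 * zpow q m)%C <> 0).
  { intros m E. apply (H6 m). replace (/ x ^ 6 * zpow q m)%C
      with (1 - (1 - / x ^ 6 * zpow q m))%C by ring. rewrite E; ring. }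
  assert (G1 : forall m, (1 - x * zpow q m)%C <> 0).
  { intros m E. apply (H1 m). replace (x * zpow q m)%C
      with (1 - (1 - x * zpow q m))%C by ring. rewrite E; ring. }
  symmetry.
  transitivity ((zprod (fun m => 1 - x ^ 3 * zpow q m) N * zprod (fun m => 1 - / x ^ 5 * zpow q m) N
     * zprod (fun m => 1 - / x ^ 2 * zpow q m) N) / (zprod (fun m => 1 - / x ^ 6 * zpow q m) N
     * zprod (fun m => 1 - x * zpow q m) N ^ 2))%C.
  - rewrite <- !zprod_mult, <- zprod_pow, <- zprod_mult, <- zprod_div.
    + apply zprod_ext; intros m. unfold nome_factor, Cdiv. f_equal; [ring | f_equal; ring].
    + intros m. apply Cmult_neq_0; auto. now apply Cpow_nz.
  - pose proof (zprod_neq_0 _ N G6) as Z6. pose proof (zprod_neq_0 _ N G1) as Z1.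
    rewrite zprod_theta in Z6, Z1 by auto. rewrite !zprod_theta by auto using Cpow_nz.
    set (c := fun a => Cpartial_prod (fun j => - (a / q ^ S j))%C N) in *.
    fold (c x) (c (/ x ^ 6)%C) in Z1, Z6.
    fold (c x) (c (/ x ^ 6)%C) (c (/ x ^ 5)%C) (c (/ x ^ 2)%C) (c (x ^ 3)%C).
    (* The divergent monomials cancel, again by equality of the degrees and of the sums of the
       multiples. *)
    assert (Ec : (c (x ^ 3) * c (/ x ^ 5) * c (/ x ^ 2) = c (/ x ^ 6) * (c x * c x))%C).
    { unfold c. rewrite <- !Cpartial_prod_mult. apply Cpartial_prod_ext; intros j _.
      pose proof (Cpow_nz q (S j) Hq0). field; auto. }
    set (A6 := (Cpartial_prod (theta_factor q (/ x ^ 6)) N * (1 - / x ^ 6 * q ^ N))%C) in *.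
    set (A1 := (Cpartial_prod (theta_factor q x) N * (1 - x * q ^ N))%C) in *.
    set (A3 := (Cpartial_prod (theta_factor q (x ^ 3)) N * (1 - x ^ 3 * q ^ N))%C) in *.
    set (A5 := (Cpartial_prod (theta_factor q (/ x ^ 5)) N * (1 - / x ^ 5 * q ^ N))%C) in *.
    set (A2 := (Cpartial_prod (theta_factor q (/ x ^ 2)) N * (1 - / x ^ 2 * q ^ N))%C) in *.
    assert (A6 <> 0) by (intros E; apply Z6; rewrite E; ring).
    assert (A1 <> 0) by (intros E; apply Z1; rewrite E; ring).
    assert (c (/ x ^ 6)%C <> 0) by (intros E; apply Z6; rewrite E; ring).
    assert (c x <> 0) by (intros E; apply Z1; rewrite E; ring).
    transitivity (A3 * A5 * A2 * (c (x ^ 3) * c (/ x ^ 5) * c (/ x ^ 2))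
      / (A6 * A1 ^ 2 * (c (/ x ^ 6) * (c x * c x))))%C.
    + generalize dependent (c (/ x ^ 6)%C); intros c6 **. unfold Cdiv; simpl.
      f_equal; [ring | f_equal; ring].
    + rewrite Ec. field; auto.
Qed.

(** The weight (1 + |n|)^(-3/2), compared with the increments of 4/sqrt n. *)
Lemma sqrt_cube_weight_cv :
  exists B : R, is_lim_seq (zsumR (fun n => / sqrt (1 + Rabs (IZR n)) ^ 3)) B.
Proof.
  assert (P : forall n, 0 < sqrt (INR (S n))) by (intros; apply sqrt_lt_R0, lt_0_INR; lia).
  destruct (Rpartial_sum_cv_bound (fun j => 2 / sqrt (INR (S (S j))) ^ 3)
    (fun j => 4 / sqrt (INR (S j)))) as [B HB].
  - intros n. pose proof (pow_lt _ 3 (P (S n))). apply Rdiv_le_0_compat; lra.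
  - intros n. pose proof (P n). apply Rdiv_le_0_compat; lra.
  - intros n. pose proof (P n) as Ps. pose proof (P (S n)) as Pt.
    assert (Es : sqrt (INR (S n)) * sqrt (INR (S n)) = INR (S n)) by (apply sqrt_sqrt, pos_INR).
    assert (Et : sqrt (INR (S (S n))) * sqrt (INR (S (S n))) = INR (S n) + 1)
      by (rewrite sqrt_sqrt by apply pos_INR; apply S_INR).
    set (s := sqrt (INR (S n))) in *. set (t := sqrt (INR (S (S n)))) in *.
    assert (Hst : s <= t) by nra.
    assert (E : (t - s) * (t + s) = 1) by nra.
    assert (Hts : 1 <= 2 * t * (t - s)) by nra.
    replace (4 / s - 4 / t) with (4 * (t - s) / (s * t)) by (field; lra).
    apply Rmult_le_reg_r with (s * t ^ 3); [apply Rmult_lt_0_compat; auto; now apply pow_lt|].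
    replace (2 / t ^ 3 * (s * t ^ 3)) with (2 * s) by (field; lra).
    replace (4 * (t - s) / (s * t) * (s * t ^ 3)) with (2 * t * (2 * t * (t - s))) by (field; lra).
    nra.
  - exists (1 + B).
    apply is_lim_seq_ext with (fun N => 1 + Rpartial_sum (fun j => 2 / sqrt (INR (S (S j))) ^ 3) N).
    + intros N. unfold zsumR. rewrite Rabs_R0, Rplus_0_r, sqrt_1. f_equal; [field|].
      induction N as [|N IH]; [reflexivity|]. cbn [Rpartial_sum]. rewrite IH. f_equal.
      unfold zpos, zneg. rewrite opp_IZR, Rabs_Ropp, <- INR_IZR_INZ.
      rewrite Rabs_pos_eq by apply pos_INR. rewrite (S_INR (S N)), (Rplus_comm 1).
      unfold Rdiv; ring.
    + apply is_lim_seq_plus'; auto using is_lim_seq_const.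
Qed.

(** The first two bounds keep the lattice points away from 6z and -z, at a squared distance of the
    order of (1 + |m|)(1 + |n|). The cube of their square root turns the O(l^-3) of the factors into
    a majorant in product form; the remaining hypotheses keep the denominators of rows and columns
    from vanishing. *)
Lemma theta_quotient_S (w z : C) (kappa : R) :
  0 < Im w -> 0 < kappa ->
  (forall m n : Z, kappa * ((1 + Rabs (IZR m)) * (1 + Rabs (IZR n))) <=
     Cmod (RtoC (IZR m) * w + RtoC (IZR n) - 6 * z) ^ 2) ->
  (forall m n : Z, kappa * ((1 + Rabs (IZR m)) * (1 + Rabs (IZR n))) <=
     Cmod (RtoC (IZR m) * w + RtoC (IZR n) + z) ^ 2) ->
  (forall m, (/ qnome z ^ 6 * zpow (qnome w) m)%C <> 1) ->
  (forall m, (qnome z * zpow (qnome w) m)%C <> 1) ->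
  (forall m, (/ qnome (z / w) ^ 6 * zpow (qnome (- (1) / w)) m)%C <> 1) ->
  (forall m, (qnome (z / w) * zpow (qnome (- (1) / w)) m)%C <> 1) ->
  theta_quotient (qnome w) (qnome z) = theta_quotient (qnome (- (1) / w)) (qnome (z / w)).
Proof.
  intros Hw Hk B6 B1 H6 H1 H6' H1'.
  assert (w0 : w <> 0) by (intros ->; simpl in Hw; lra).
  assert (Hq := Cmod_qnome_lt_1 w Hw).
  assert (Him : 0 < Im (- (1) / w)).
  { destruct w as [a b]. simpl in Hw. unfold Cdiv, Cinv, Cmult, Copp, RtoC, Im; simpl.
    assert (0 < a * (a * 1) + b * (b * 1)) by nra.
    replace (- (1) * (- b / (a * (a * 1) + b * (b * 1))) + - 0 * (a / (a * (a * 1) + b * (b * 1))))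
      with (b / (a * (a * 1) + b * (b * 1))) by (field; lra).
    now apply Rdiv_lt_0_compat. }
  assert (Hq' := Cmod_qnome_lt_1 _ Him).
  assert (sub1 : forall u : C, u <> 1 -> (1 - u)%C <> 0).
  { intros u Hu E. apply Hu. replace u with (1 - (1 - u))%C by ring. rewrite E; ring. }
  set (S := fun n : Z => sqrt (1 + Rabs (IZR n))).
  assert (HS : forall n, 0 < S n).
  { intros n. apply sqrt_lt_R0. pose proof (Rabs_pos (IZR n)); lra. }
  assert (HS2 : forall n, S n * S n = 1 + Rabs (IZR n)).
  { intros n. apply sqrt_sqrt. pose proof (Rabs_pos (IZR n)); lra. }
  set (k := sqrt kappa). assert (Pk : 0 < k) by (now apply sqrt_lt_R0).
  assert (k2 : k * k = kappa) by (apply sqrt_sqrt; lra).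
  assert (Low : forall m n u, kappa * ((1 + Rabs (IZR m)) * (1 + Rabs (IZR n))) <= Cmod u ^ 2 ->
     k * (S m * S n) <= Cmod u).
  { intros m n u H. rewrite <- k2, <- !HS2 in H. pose proof (HS m); pose proof (HS n).
    apply Rsqr_incr_0; [unfold Rsqr; simpl in H; nra | | apply Cmod_ge_0].
    apply Rmult_le_pos; [lra | apply Rmult_le_pos; lra]. }
  set (l := fun m n : Z => (RtoC (IZR m) * w + RtoC (IZR n))%C).
  assert (L6 : forall m n, k * (S m * S n) <= Cmod (l m n - 6 * z)) by (intros; now apply Low).
  assert (L1 : forall m n, k * (S m * S n) <= Cmod (l m n + z)) by (intros; now apply Low).
  assert (Pp : forall m n, 0 < k * (S m * S n)).
  { intros m n. apply Rmult_lt_0_compat; auto. apply Rmult_lt_0_compat; auto. }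
  assert (N6 : forall m n, (l m n - 6 * z)%C <> 0).
  { intros m n. apply Cmod_gt_0. eapply Rlt_le_trans; [apply Pp | apply L6]. }
  assert (N1 : forall m n, (l m n + z)%C <> 0).
  { intros m n. apply Cmod_gt_0. eapply Rlt_le_trans; [apply Pp | apply L1]. }
  set (b := fun n : Z => / sqrt (1 + Rabs (IZR n)) ^ 3).
  destruct sqrt_cube_weight_cv as [B HB]. fold b in HB.
  assert (Pb : forall n, 0 <= b n).
  { intros n. left. apply Rinv_0_lt_compat, pow_lt, HS. }
  set (c := 36 * Cmod z ^ 3 / k ^ 3).
  assert (Pc : 0 <= c).
  { unfold c. apply Rdiv_le_0_compat; [|now apply pow_lt].
    pose proof (pow_le _ 3 (Cmod_ge_0 z)); lra. }
  assert (E : Clim (zprod (fun m => nome_factor (qnome z) (zpow (qnome w) m)))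
     (theta_quotient (qnome (- (1) / w)) (qnome (z / w)))).
  { apply (zprod_exchange (fun m n => lattice_factor z (l m n)) (fun m => c * b m) b (c * B) B _
      (fun n => nome_factor (qnome (z / w)) (zpow (qnome (- (1) / w)) (- n)))); auto.
    - intros m. apply Rmult_le_pos; auto.
    - intros m n. rewrite lattice_factor_minus_1, Cmod_div by auto using Cmult_neq_0, Cpow_nz.
      rewrite !Cmod_mult, !Cmod_pow, Cmod_R, Rabs_pos_eq by lra.
      replace (c * b m * b n) with (36 * Cmod z ^ 3 * / (k * (S m * S n) * (k * (S m * S n)) ^ 2)).
      2: { unfold c, b. fold (S m) (S n). pose proof (HS m); pose proof (HS n). field.
           repeat split; lra. }
      apply Rmult_le_compat_l; [pose proof (pow_le _ 3 (Cmod_ge_0 z)); lra|].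
      specialize (L6 m n). specialize (L1 m n). specialize (Pp m n).
      apply Rinv_le_contravar; [apply Rmult_lt_0_compat; auto; now apply pow_lt|].
      apply Rmult_le_compat; [lra | apply pow_le; lra | auto | apply pow_incr; lra].
    - apply is_lim_seq_ext with (fun N => c * zsumR b N); [intros; now rewrite zsumR_scal|].
      apply is_lim_seq_mult'; auto using is_lim_seq_const.
    - intros m. rewrite <- qnome_Zmult. apply lattice_row; rewrite qnome_Zmult.
      + replace (zpow (qnome w) m / qnome z ^ 6)%C with (/ qnome z ^ 6 * zpow (qnome w) m)%C
          by (unfold Cdiv; ring). auto.
      + rewrite Cmult_comm. auto.
    - intros n.
      apply Clim_ext with (zprod (fun m => lattice_factor (z / w) (RtoC (IZR n) / w + RtoC (IZR m)))).
      + intros N. apply zprod_ext; intros m.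
        rewrite <- (lattice_factor_homogeneous z (l m n) w) by auto. f_equal.
        unfold l. field; auto.
      + assert (En : qnome (RtoC (IZR n) / w) = zpow (qnome (- (1) / w)) (- n)).
        { rewrite <- qnome_Zmult. f_equal. rewrite opp_IZR, RtoC_opp. field; auto. }
        rewrite <- En. apply lattice_row; rewrite En.
        * replace (zpow (qnome (- (1) / w)) (- n) / qnome (z / w) ^ 6)%C
            with (/ qnome (z / w) ^ 6 * zpow (qnome (- (1) / w)) (- n))%C
            by (unfold Cdiv; ring). auto.
        * rewrite Cmult_comm. auto.
    - eapply Clim_ext; [intros N; symmetry; apply (zprod_opp
        (fun n => nome_factor (qnome (z / w)) (zpow (qnome (- (1) / w)) n)))|].
      apply nome_product; auto using qnome_neq_0. }
  eapply Clim_unique; [|exact E]. apply nome_product; auto using qnome_neq_0.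
Qed.

(** * The function [h] *)

Definition th (Q : C) (r : nat) : C := theta (Q ^ 7) (Q ^ r).

Lemma Cmod_pow7 (Q : C) : 0 < Cmod Q < 1 -> 0 < Cmod (Q ^ 7) < 1.
Proof.
  intros H. rewrite Cmod_pow. split; [apply pow_lt; lra | apply pow_lt_1_compat; [lra | lia]].
Qed.

Lemma zpow_neq_1 (Q : C) (n : Z) : 0 < Cmod Q < 1 -> n <> 0%Z -> zpow Q n <> 1.
Proof.
  intros HQ Hn E. assert (Q0 : Q <> 0) by (apply Cmod_gt_0; lra).
  assert (P : forall k, Cmod (zpow Q (Z.of_nat (S k))) < 1).
  { intros k. rewrite zpow_of_nat. apply Cmod_pow_lt_1; lra. }
  destruct (Z_lt_ge_dec 0 n) as [H|H].
  - specialize (P (Z.to_nat (n - 1))).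
    replace (Z.of_nat (S (Z.to_nat (n - 1)))) with n in P by lia.
    rewrite E, Cmod_1 in P. lra.
  - specialize (P (Z.to_nat (- n - 1))).
    replace (Z.of_nat (S (Z.to_nat (- n - 1)))) with (- n)%Z in P by lia.
    rewrite zpow_opp, E in P by auto. replace (/ 1)%C with (RtoC 1) in P by field.
    rewrite Cmod_1 in P. lra.
Qed.

Lemma zpow_pow_neq_1 (Q : C) (r m : Z) : 0 < Cmod Q < 1 -> (r mod 7 <> 0)%Z ->
  (zpow Q r * zpow (Q ^ 7) m)%C <> 1.
Proof.
  intros HQ Hr. assert (Q0 : Q <> 0) by (apply Cmod_gt_0; lra).
  change (Q ^ 7)%C with (zpow Q 7). rewrite <- zpow_mult_r, <- zpow_add by auto.
  apply zpow_neq_1; auto. intros E. apply Hr.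
  replace r with (- m * 7)%Z by lia. apply Z.mod_mul; lia.
Qed.

Lemma th_neq_0 (Q : C) (r : nat) : 0 < Cmod Q < 1 -> (0 < r < 7)%nat -> th Q r <> 0.
Proof.
  intros HQ Hr. assert (Q0 : Q <> 0) by (apply Cmod_gt_0; lra).
  apply theta_neq_0; auto using Cmod_pow7, Cpow_nz.
  intros m. rewrite <- zpow_of_nat. apply zpow_pow_neq_1; auto.
  rewrite Z.mod_small; lia.
Qed.

Lemma th_reflect (Q : C) (r s : nat) : 0 < Cmod Q < 1 -> (r + s = 7)%nat -> th Q r = th Q s.
Proof.
  intros HQ Hrs. assert (Q0 : Q <> 0) by (apply Cmod_gt_0; lra).
  unfold th. rewrite <- (theta_q_div (Q ^ 7) (Q ^ s)) by auto using Cmod_pow7, Cpow_nz.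
  f_equal. rewrite <- Hrs, Cpow_add_r. pose proof (Cpow_nz Q s Q0). field; auto.
Qed.

Lemma th_shift (Q : C) (r : nat) : 0 < Cmod Q < 1 ->
  th Q (7 + r) = (- th Q r / Q ^ r)%C.
Proof.
  intros HQ. assert (Q0 : Q <> 0) by (apply Cmod_gt_0; lra).
  unfold th. rewrite Cpow_add_r. apply theta_q_mult; auto using Cmod_pow7, Cpow_nz.
Qed.

Lemma th_inv (Q : C) (r : nat) : 0 < Cmod Q < 1 ->
  theta (Q ^ 7) (/ Q ^ r) = (- th Q r / Q ^ r)%C.
Proof.
  intros HQ. assert (Q0 : Q <> 0) by (apply Cmod_gt_0; lra).
  apply theta_inv; auto using Cmod_pow7, Cpow_nz.
Qed.

Lemma th_klein (Q : C) : 0 < Cmod Q < 1 ->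
  (th Q 3 * th Q 2 ^ 3 - Q * th Q 2 * th Q 1 ^ 3)%C = (th Q 3 ^ 3 * th Q 1)%C.
Proof.
  intros HQ. assert (Q0 : Q <> 0) by (apply Cmod_gt_0; lra).
  pose proof (theta_three_term (Q ^ 7) (Q ^ 3) (Q ^ 2) (Q ^ 1) (Q ^ 0) (Cmod_pow7 Q HQ)
    (Cpow_nz _ _ Q0) (Cpow_nz _ _ Q0) (Cpow_nz _ _ Q0) (Cpow_nz _ _ Q0)) as E.
  rewrite <- !Cpow_add_r in E.
  assert (D : forall a b, theta (Q ^ 7) (Q ^ (a + b) / Q ^ b) = th Q a).
  { intros a b. unfold th. f_equal. rewrite Cpow_add_r. pose proof (Cpow_nz Q b Q0). field; auto. }
  pose proof (D 1%nat 2%nat) as D32. pose proof (D 2%nat 1%nat) as D31. pose proof (D 3%nat 0%nat) as D30.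
  pose proof (D 1%nat 1%nat) as D21. pose proof (D 2%nat 0%nat) as D20. pose proof (D 1%nat 0%nat) as D10.
  cbn [Nat.add] in *. rewrite D32, D31, D30, D21, D20, D10 in E.
  fold (th Q 5) (th Q 1) (th Q 4) (th Q 2) (th Q 3) in E.
  rewrite (th_reflect Q 5 2), (th_reflect Q 4 3) in E by auto.
  (* After reflection the three-term relation is -Q times the Klein relation. *)
  assert (E' : (Q * (th Q 3 * th Q 2 ^ 3 - Q * th Q 2 * th Q 1 ^ 3 - th Q 3 ^ 3 * th Q 1))%C = 0).
  { transitivity (- (0))%C; [rewrite <- E|]; ring. }
  assert (E2 : (th Q 3 * th Q 2 ^ 3 - Q * th Q 2 * th Q 1 ^ 3 - th Q 3 ^ 3 * th Q 1)%C = 0).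
  { apply (Cmult_cancel_r _ _ Q); auto. rewrite Cmult_comm, E'. ring. }
  replace (th Q 3 * th Q 2 ^ 3 - Q * th Q 2 * th Q 1 ^ 3)%C
    with (th Q 3 * th Q 2 ^ 3 - Q * th Q 2 * th Q 1 ^ 3 - th Q 3 ^ 3 * th Q 1
      + th Q 3 ^ 3 * th Q 1)%C by ring.
  rewrite E2. ring.
Qed.

Lemma pow_n_Cpow (x : C) (n : nat) : @pow_n C_Ring x n = (x ^ n)%C.
Proof. induction n; simpl; auto. Qed.

(** The residues r and 7 - r modulo 7 combine into one theta function; as there are three of them
    above and three below, the factor (q^7; q^7) cancels. *)
Lemma h_theta (tau : C) : 0 < Im tau ->
  h tau = (th (qnome tau) 3 * th (qnome tau) 2 ^ 2 / (qnome tau * th (qnome tau) 1 ^ 3))%C.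
Proof.
  intros Htau. set (Q := qnome tau).
  assert (HQ : 0 < Cmod Q < 1) by now apply Cmod_qnome_lt_1.
  assert (Q0 : Q <> 0) by (apply Cmod_gt_0; lra).
  pose proof (Cmod_pow7 Q HQ) as Hq.
  destruct (qfac_cv (Q ^ 7) ltac:(lra)) as [l [Hl Hl0]].
  assert (O : forall n, one_minus_qpow Q n = (1 - Q ^ n)%C).
  { intros n. unfold one_minus_qpow. now rewrite pow_n_Cpow. }
  assert (F : forall r s j, (r + s = 7)%nat -> theta_factor (Q ^ 7) (Q ^ r) j =
     (one_minus_qpow Q (7 * j + r) * one_minus_qpow Q (7 * j + s))%C).
  { intros r s j H. unfold theta_factor. rewrite !O.
    rewrite <- !Cpow_mult_r. replace (7 * S j)%nat with (r + (7 * j + s))%nat by lia.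
    rewrite (Cpow_add_r Q r), (Cpow_add_r Q (7 * j) r).
    pose proof (Cpow_nz Q r Q0). field; auto. }
  assert (NZ : forall n, one_minus_qpow Q (S n) <> 0).
  { intros n. rewrite O.
    apply Cmod_lt_1_neq_1, Cmod_pow_lt_1; lra. }
  set (P := fun r N => Cpartial_prod (theta_factor (Q ^ 7) (Q ^ r)) N).
  assert (P1 : forall N, P 1%nat N <> 0).
  { intros N. apply Cpartial_prod_neq_0. intros j. rewrite (F 1%nat 6%nat) by auto.
    replace (7 * j + 1)%nat with (S (7 * j)) by lia.
    replace (7 * j + 6)%nat with (S (7 * j + 5)) by lia. apply Cmult_neq_0; auto. }
  assert (E : forall N, Cpartial_prod (h_factor Q) N = (P 3%nat N * P 2%nat N ^ 2 / P 1%nat N ^ 3)%C).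
  { induction N as [|N IH].
    - unfold P; simpl. field.
    - cbn [Cpartial_prod]. rewrite IH. unfold P; cbn [Cpartial_prod].
      fold (P 3%nat N) (P 2%nat N) (P 1%nat N). pose proof (P1 N).
      rewrite (F 3%nat 4%nat), (F 2%nat 5%nat), (F 1%nat 6%nat) by auto.
      unfold h_factor.
      rewrite (pow_n_Cpow (one_minus_qpow Q (7 * N + 2)) 2), (pow_n_Cpow (one_minus_qpow Q (7 * N + 5)) 2),
        (pow_n_Cpow (one_minus_qpow Q (7 * N + 1)) 3), (pow_n_Cpow (one_minus_qpow Q (7 * N + 6)) 3).
      replace (7 * N + 1)%nat with (S (7 * N)) by lia.
      replace (7 * N + 6)%nat with (S (7 * N + 5)) by lia.
      pose proof (NZ (7 * N)%nat). pose proof (NZ (7 * N + 5)%nat).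
      field; auto. }
  assert (L : forall r, Clim (P r) (th Q r / l)%C).
  { intros r. apply theta_product; auto using Cpow_nz. }
  pose proof (th_neq_0 Q 1 HQ ltac:(lia)) as T1.
  assert (Hh : Cprod_inf (h_factor Q) = (th Q 3 * th Q 2 ^ 2 / th Q 1 ^ 3)%C).
  { apply Cprod_inf_Clim. eapply Clim_ext; [intros N; symmetry; apply E|].
    replace (th Q 3 * th Q 2 ^ 2 / th Q 1 ^ 3)%C
      with (th Q 3 / l * (th Q 2 / l) ^ 2 / (th Q 1 / l) ^ 3)%C by (field; auto).
    apply Clim_div; [apply Cpow_nz, Cdiv_nz; auto | apply Clim_mult; auto | ]; now apply Clim_pow. }
  unfold h. fold Q. rewrite Hh. field; auto.
Qed.

(** The three inversions contribute the sign (-1)^3 and the power Q^(6 - 5 - 2), which is the factor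
    1/q of h. *)
Lemma theta_quotient_h (Q : C) : 0 < Cmod Q < 1 ->
  theta_quotient (Q ^ 7) Q = (- (th Q 3 * th Q 2 ^ 2 / (Q * th Q 1 ^ 3)))%C.
Proof.
  intros HQ. assert (Q0 : Q <> 0) by (apply Cmod_gt_0; lra).
  unfold theta_quotient. fold (th Q 3). rewrite !th_inv by auto.
  replace (theta (Q ^ 7) Q) with (th Q 1) by (unfold th; now rewrite Cpow_1_r).
  rewrite (th_reflect Q 5 2), (th_reflect Q 6 1) by auto.
  pose proof (th_neq_0 Q 1 HQ ltac:(lia)). field; auto.
Qed.

(** Multiplied by -3, the multiples become -9, 15, 6 over 18, -3, -3. Inversion, shifts by 7 and
    reflection reduce them to 2, 1, 1 over 3, 3, 3. *)
Lemma theta_quotient_inv_cube (Q : C) : 0 < Cmod Q < 1 ->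
  theta_quotient (Q ^ 7) (/ Q ^ 3) = (Q * th Q 2 * th Q 1 ^ 2 / th Q 3 ^ 3)%C.
Proof.
  intros HQ. assert (Q0 : Q <> 0) by (apply Cmod_gt_0; lra).
  assert (I : forall k, ((/ Q ^ 3) ^ k = / Q ^ (3 * k))%C).
  { intros k. rewrite Cpow_inv, Cpow_mult_r by (now apply Cpow_nz). reflexivity. }
  assert (II : forall k, (/ (/ Q ^ 3) ^ k = Q ^ (3 * k))%C).
  { intros k. rewrite I. pose proof (Cpow_nz Q (3 * k) Q0). field; auto. }
  unfold theta_quotient. rewrite !II, I. cbn [Nat.mul Nat.add].
  fold (th Q 15) (th Q 6) (th Q 18). rewrite !th_inv by auto.
  rewrite (th_shift Q 2 HQ : th Q 9 = _).
  rewrite (th_shift Q 8 HQ : th Q 15 = _), (th_shift Q 1 HQ : th Q 8 = _).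
  rewrite (th_shift Q 11 HQ : th Q 18 = _), (th_shift Q 4 HQ : th Q 11 = _).
  rewrite (th_reflect Q 6 1), (th_reflect Q 4 3) by auto.
  pose proof (th_neq_0 Q 3 HQ ltac:(lia)). field; auto.
Qed.

(** * Distance estimates and the conclusion *)

Lemma lattice_form_bound (w : C) : 0 < Im w -> exists c, 0 < c /\
  forall a b : R, c * (Rabs a * Rabs b) <= Cmod (RtoC a * w + RtoC b) ^ 2.
Proof.
  intros Hw. destruct w as [x y]. simpl in Hw.
  (* Since |b| <= |u| + |a x| for u = a x + b, one has |a b| <= u^2/2 + (1/2 + |x|) a^2; this K
     makes K (u^2 + (a y)^2) dominate the right-hand side. *)
  set (K := / 2 + (/ 2 + Rabs x) / (y * y)).
  pose proof (Rabs_pos x) as Hx.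
  assert (Hyy : 0 < y * y) by nra.
  assert (HK : 0 < K).
  { unfold K. assert (0 < (/ 2 + Rabs x) / (y * y)) by (apply Rdiv_lt_0_compat; lra). lra. }
  exists (/ K); split; [now apply Rinv_0_lt_compat|]. intros a b.
  rewrite Cmod2_alt. unfold RtoC, Cmult, Cplus, Re, Im; simpl fst; simpl snd.
  set (u := a * x - 0 * y + b). replace (a * y + 0 * x + 0) with (a * y) by ring.
  assert (Hb : Rabs b <= Rabs u + Rabs a * Rabs x).
  { replace b with (u - a * x) by (unfold u; ring). rewrite <- Rabs_mult.
    eapply Rle_trans; [apply Rabs_triang|]. rewrite Rabs_Ropp. lra. }
  apply Rmult_le_reg_l with K; auto. rewrite <- Rmult_assoc, Rinv_r, Rmult_1_l by lra.
  assert (Ey : K * (u ^ 2 + (a * y) ^ 2) =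
    K * u ^ 2 + / 2 * (a * y) ^ 2 + (/ 2 + Rabs x) * a ^ 2) by (unfold K; field; lra).
  rewrite Ey. rewrite <- (pow2_abs u), <- (pow2_abs a).
  pose proof (Rabs_pos a); pose proof (Rabs_pos u). pose proof (Rabs_pos b).
  assert (/ 2 <= K) by (unfold K; assert (0 < (/ 2 + Rabs x) / (y * y)) by (apply Rdiv_lt_0_compat; lra); lra).
  assert (0 <= (a * y) ^ 2) by apply pow2_ge_0.
  assert (Rabs a * Rabs b <= Rabs a * (Rabs u + Rabs a * Rabs x)) by (apply Rmult_le_compat_l; auto).
  assert (Rabs a * Rabs u <= / 2 * Rabs a ^ 2 + / 2 * Rabs u ^ 2)
    by (pose proof (pow2_ge_0 (Rabs a - Rabs u)); nra).
  assert (/ 2 * Rabs u ^ 2 <= K * Rabs u ^ 2) by (apply Rmult_le_compat_r; [apply pow2_ge_0 | lra]).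
  nra.
Qed.

Ltac integer_distance := intros n;
  match goal with |- _ <= Rabs (IZR n + ?c) =>
    let H := fresh in
    assert (H : (n <= -1 \/ n = 0 \/ n = 1 \/ n = 2 \/ 3 <= n)%Z) by lia;
    destruct H as [H|[H|[H|[H|H]]]];
    [apply IZR_le in H | subst n | subst n | subst n | apply IZR_le in H]; split_Rabs; lra
  end.

Theorem theorem3 (tau : C) (Htau : 0 < Im tau) :
  h (Cdiv (Cminus (Cmult (RtoC 2) tau) (RtoC 1))
          (Cminus (Cmult (RtoC 7) tau) (RtoC 3)))
  = Cdiv (Cminus (h tau) (RtoC 1)) (h tau).
Proof.
  set (w := (7 * tau - 3)%C). set (g := ((2 * tau - 1) / w)%C).
  assert (Hw : 0 < Im w).
  { unfold w. destruct tau as [a b]. simpl in *. lra. }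
  assert (w0 : w <> 0) by (intros E; rewrite E in Hw; simpl in Hw; lra).
  assert (C7 : RtoC 7 <> 0) by (apply RtoC_neq_0; lra).
  (* Both identities come from the determinant 2 (-3) - (-1) 7 = 1 of the substitution. *)
  assert (Eg : (- (1) / w = 7 * g - 2)%C).
  { unfold g. transitivity ((7 * (2 * tau - 1) - 2 * w) / w)%C; [|field; auto].
    f_equal. unfold w. ring. }
  assert (Ez : (tau / w = 1 - 3 * g)%C).
  { unfold g. transitivity ((w - 3 * (2 * tau - 1)) / w)%C; [|field; auto].
    f_equal. unfold w. ring. }
  assert (Hg : 0 < Im g).
  { destruct w as [a b]. simpl in Hw.
    assert (P : 0 < a * (a * 1) + b * (b * 1)) by nra.
    assert (E : Im (- (1) / (a, b))%C = b / (a * (a * 1) + b * (b * 1))).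
    { unfold Cdiv, Cinv, Cmult, Copp, RtoC, Im; simpl. field; lra. }
    assert (Pb : 0 < b / (a * (a * 1) + b * (b * 1))) by now apply Rdiv_lt_0_compat.
    rewrite Eg in E. destruct g as [c d]. unfold Cmult, Cminus, Cplus, Copp, RtoC in E. simpl in *. lra. }
  set (Q := qnome tau). set (Q' := qnome g).
  assert (HQ : 0 < Cmod Q < 1) by now apply Cmod_qnome_lt_1.
  assert (HQ' : 0 < Cmod Q' < 1) by now apply Cmod_qnome_lt_1.
  assert (Q0 : Q <> 0) by apply qnome_neq_0.
  assert (Q0' : Q' <> 0) by apply qnome_neq_0.
  assert (Ew : qnome w = (Q ^ 7)%C).
  { unfold w. replace (7 * tau - 3)%C with (RtoC (IZR 7) * tau + RtoC (IZR (-3)))%C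
      by (change (-3)%Z with (- (3))%Z; rewrite opp_IZR, RtoC_opp; ring).
    rewrite qnome_add, qnome_Z, qnome_Zmult. fold Q. change (zpow Q 7) with (Q ^ 7)%C. ring. }
  assert (Ew' : qnome (- (1) / w) = (Q' ^ 7)%C).
  { rewrite Eg. replace (7 * g - 2)%C with (RtoC (IZR 7) * g + RtoC (IZR (-2)))%C
      by (change (-2)%Z with (- (2))%Z; rewrite opp_IZR, RtoC_opp; ring).
    rewrite qnome_add, qnome_Z, qnome_Zmult. fold Q'. change (zpow Q' 7) with (Q' ^ 7)%C. ring. }
  assert (Ez' : qnome (tau / w) = (/ Q' ^ 3)%C).
  { rewrite Ez. replace (1 - 3 * g)%C with (RtoC (IZR (-3)) * g + RtoC (IZR 1))%C
      by (change (-3)%Z with (- (3))%Z; rewrite opp_IZR, RtoC_opp; ring).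
    rewrite qnome_add, qnome_Z, qnome_Zmult. fold Q'.
    change (zpow Q' (-3)) with (/ Q' ^ 3)%C. ring. }
  destruct (lattice_form_bound w Hw) as [c [Hc Hbd]].
  (* As tau = (w + 3)/7, adding z shifts the coordinates (m, n) by (1/7, 3/7), and subtracting 6z
     shifts them by (-6/7, -18/7). None of the shifts is an integer; the constant 14 is attained at
     n = 1 for the shift -6/7. *)
  assert (D1 : forall n : Z, (1 + Rabs (IZR n)) / 14 <= Rabs (IZR n + 1 / 7)) by integer_distance.
  assert (D2 : forall n : Z, (1 + Rabs (IZR n)) / 14 <= Rabs (IZR n + 3 / 7)) by integer_distance.
  assert (D3 : forall n : Z, (1 + Rabs (IZR n)) / 14 <= Rabs (IZR n + - (6 / 7))) by integer_distance.
  assert (D4 : forall n : Z, (1 + Rabs (IZR n)) / 14 <= Rabs (IZR n + - (18 / 7))) by integer_distance.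
  assert (Bd : forall (m n : Z) a b (u : C), (1 + Rabs (IZR m)) / 14 <= Rabs a ->
     (1 + Rabs (IZR n)) / 14 <= Rabs b -> u = (RtoC a * w + RtoC b)%C ->
     c / 196 * ((1 + Rabs (IZR m)) * (1 + Rabs (IZR n))) <= Cmod u ^ 2).
  { intros m n a b u Ha Hb ->. eapply Rle_trans; [|apply Hbd].
    replace (c / 196 * ((1 + Rabs (IZR m)) * (1 + Rabs (IZR n))))
      with (c * ((1 + Rabs (IZR m)) / 14 * ((1 + Rabs (IZR n)) / 14))) by field.
    apply Rmult_le_compat_l; [lra|].
    pose proof (Rabs_pos (IZR m)); pose proof (Rabs_pos (IZR n)).
    apply Rmult_le_compat; lra. }
  assert (S : theta_quotient (qnome w) (qnome tau) = theta_quotient (qnome (- (1) / w)) (qnome (tau / w))).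
  { apply theta_quotient_S with (c / 196); auto.
    - lra.
    - intros m n. apply (Bd m n _ _ _ (D3 m) (D4 n)).
      unfold w. rewrite !RtoC_plus, !RtoC_opp, !RtoC_div by lra. field; auto.
    - intros m n. apply (Bd m n _ _ _ (D1 m) (D2 n)).
      unfold w. rewrite !RtoC_plus, !RtoC_div by lra. field; auto.
    - intros m. fold Q. rewrite Ew. change (/ Q ^ 6)%C with (zpow Q (-6)).
      apply zpow_pow_neq_1; auto. discriminate.
    - intros m. fold Q. rewrite Ew, <- (zpow_1 Q) at 1.
      apply zpow_pow_neq_1; auto. discriminate.
    - intros m. rewrite Ew', Ez'.
      replace (/ (/ Q' ^ 3) ^ 6)%C with (zpow Q' 18)
        by (change (zpow Q' 18) with (Q' ^ 18)%C; field; auto).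
      apply zpow_pow_neq_1; auto. discriminate.
    - intros m. rewrite Ew', Ez'. change (/ Q' ^ 3)%C with (zpow Q' (-3)).
      apply zpow_pow_neq_1; auto. discriminate. }
  rewrite Ew, Ew', Ez' in S. fold Q in S.
  rewrite theta_quotient_h, theta_quotient_inv_cube in S by auto.
  fold w. fold g. rewrite (h_theta g Hg). fold Q'.
  assert (Eh : h tau = (- (Q' * th Q' 2 * th Q' 1 ^ 2 / th Q' 3 ^ 3))%C).
  { rewrite <- S, h_theta by auto. fold Q. ring. }
  rewrite Eh.
  pose proof (th_klein Q' HQ') as Kl.
  pose proof (th_neq_0 Q' 1 HQ' ltac:(lia)). pose proof (th_neq_0 Q' 2 HQ' ltac:(lia)).
  pose proof (th_neq_0 Q' 3 HQ' ltac:(lia)).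
  (* Numerator and denominator of h(g) are multiplied by theta_2 to expose the left-hand term of the
     Klein relation; the split gives 1 - 1/h(tau). *)
  transitivity (th Q' 3 * th Q' 2 ^ 3 / (Q' * th Q' 2 * th Q' 1 ^ 3))%C; [field; auto|].
  replace (th Q' 3 * th Q' 2 ^ 3)%C
    with (th Q' 3 ^ 3 * th Q' 1 + Q' * th Q' 2 * th Q' 1 ^ 3)%C by (rewrite <- Kl; ring).
  field. repeat split; auto.
Qed.
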